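(* Let $(M^{2n},\omega)$ be a compact connected symplectic manifold and $g$ some Riemannian metric on $M$. Suppose that there is an effective Hamiltonian action of the $n$-torus $T^n$ on $M$ which preserves $g$. Then there is a regular orbit of the action which is a minimal submanifold with respect to $g$.
   Context: Hamiltonian means that there is a $T^n$-invariant moment map $\mu:M\to\mathcal{G}^*$ ($\mathcal{G}$ the Lie algebra of $T^n$) with $d(\mu(v))=i_{X_v}\omega$ for all $v\in\mathcal{G}$, where $X_v$ is the vector field on $M$ induced by $v$; the action preserves $\omega$. A regular orbit is an orbit with finite stabilizer. Minimal means vanishing mean curvature. Note that $g$ is not assumed to be related to $\omega$ beyond being invariant under the action. *)

(* Defs.v *)
From HB Require Import structures.
From mathcomp Require Import all_boot all_order all_algebra.
From mathcomp Require Import generic_quotient ring_quotient archimedean.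
From mathcomp Require Import all_classical all_reals all_analysis.

Set Implicit Arguments.
Unset Strict Implicit.
Unset Printing Implicit Defensive.

Import Order.TTheory GRing.Theory Num.Theory.
Import numFieldNormedType.Exports.

Local Open Scope classical_set_scope.
Local Open Scope ring_scope.

(* Vectors are row vectors throughout, and a bilinear form with matrix [B]
   takes the value [u *m B *m v^T] on [(u, v)]. *)

Section SmoothFunctions.
Context {R : realType} {V W : normedModType R}.

(* Only used for finite-dimensional V and W and open U. *)
Fixpoint Ck (k : nat) (U : set V) (f : V -> W) : Prop :=
  match k with
  | 0 => {in U, continuous f}
  | k'.+1 => {in U, forall x, differentiable f x} /\
             forall v : V, Ck k' U (fun x => 'D_v f x)
  end.

Definition smooth_on (U : set V) (f : V -> W) : Prop := forall k, Ck k U f.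

End SmoothFunctions.

(* A smooth manifold is given by some smooth atlas, not necessarily maximal.
   [cmap i] and [cinv i] are mutually inverse homeomorphisms between [cdom i]
   and its image; their values elsewhere are irrelevant. *)
Record manifold (R : realType) (m : nat) := Manifold {
  carrier :> topologicalType;
  cidx : Type;
  cdom : cidx -> set carrier;
  cmap : cidx -> carrier -> 'rV[R]_m;
  cinv : cidx -> 'rV[R]_m -> carrier;
  man_hausdorff : hausdorff_space carrier;
  man_second_countable : @second_countable carrier;
  cdom_open : forall i, open (cdom i);
  cdom_cover : forall x, exists i, cdom i x;
  cimg_open : forall i, open (cmap i @` cdom i);
  cmapK : forall i, {in cdom i, cancel (cmap i) (cinv i)};
  cmap_continuous : forall i, {in cdom i, continuous (cmap i)};
  cinv_continuous : forall i, {in cmap i @` cdom i, continuous (cinv i)};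
  transition_smooth : forall i j,
    smooth_on ((cmap i @` cdom i) `&` cinv i @^-1` cdom j) (cmap j \o cinv i)
}.

Definition cimg (R : realType) m (M : manifold R m) (i : cidx M) :
  set 'rV[R]_m := cmap i @` cdom i.

Definition smooth_into {R : realType} {V : normedModType R} {m : nat}
    {M : manifold R m} (U : set V) (f : V -> M) : Prop :=
  {in U, continuous f} /\
  forall i : cidx M, smooth_on (U `&` f @^-1` cdom i) (cmap i \o f).

Section Tensors.
Context {R : realType} {m : nat} (M : manifold R m).

Definition basis_vec {k : nat} (a : 'I_k) : 'rV[R]_k := delta_mx 0 a.

Definition bil {k : nat} (B : 'M[R]_k) (u v : 'rV[R]_k) : R :=
  (u *m B *m v^T) 0 0.

(* The components of a covariant 2-tensor field in every chart. *)
Definition components : Type := cidx M -> 'rV[R]_m -> 'M[R]_m.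

(* The pullback of [T] by [f] is [T]. *)
Definition preserves (f : M -> M) (T : components) : Prop :=
  forall (i j : cidx M) (y : 'rV[R]_m),
    cimg i y -> cdom j (f (cinv i y)) ->
    let F := cmap j \o f \o cinv i in
    forall u v : 'rV[R]_m,
      bil (T i y) u v = bil (T j (F y)) ('D_u F y) ('D_v F y).

(* [preserves id T] is the law of transformation under changes of charts. *)
Definition tensor2 (T : components) : Prop :=
  (forall i, smooth_on (cimg i) (T i)) /\ preserves id T.

Definition riemannian_metric (g : components) : Prop :=
  tensor2 g /\
  forall i y, cimg i y ->
    (g i y)^T = g i y /\ forall u : 'rV[R]_m, u != 0 -> 0 < bil (g i y) u u.

Definition closed_form (w : components) : Prop :=
  forall i y, cimg i y -> forall a b c : 'I_m,
    'D_(basis_vec a) (fun z => w i z b c) y +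
    'D_(basis_vec b) (fun z => w i z c a) y +
    'D_(basis_vec c) (fun z => w i z a b) y = 0.

Definition symplectic_form (w : components) : Prop :=
  [/\ tensor2 w,
      forall i y, cimg i y -> (w i y)^T = - w i y,
      forall i y, cimg i y -> w i y \in unitmx &
      closed_form w].

End Tensors.

Section Torus.
Context (R : realType) (n : nat).

(* T^n = R^n / Z^n, with the group structure (written additively) of the
   quotient.  Its Lie algebra is R^n, with exponential map [torus_pi]; as the
   latter is a covering map defining the smooth structure of T^n, smoothness
   of maps out of T^n is smoothness of their composites with it. *)
Definition integral_vec (s : 'rV[R]_n) : bool := s \is a mxOver Num.int.

Fact integral_vec_zmod_closed : zmod_closed integral_vec.
Proof.
split; first by apply/mxOverP => i j; rewrite mxE rpred0.
move=> s t /mxOverP sZ /mxOverP tZ; apply/mxOverP => i j.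
by rewrite !mxE rpredB.
Qed.

HB.instance Definition _ :=
  GRing.isZmodClosed.Build 'rV[R]_n integral_vec integral_vec_zmod_closed.

Definition lattice : zmodClosed 'rV[R]_n := GRing.ZmodClosed.clone _ integral_vec _.

Definition torus : zmodType := Quotient.quot lattice.

Definition torus_pi (s : 'rV[R]_n) : torus :=
  (\pi_(Quotient.quot lattice) s)%qT.

End Torus.

Section TorusAction.
Context {R : realType} {n m : nat} {M : manifold R m}.
Variable act : torus R n -> M -> M.

Definition smooth_action : Prop :=
  [/\ forall x, act 0 x = x,
      forall s t x, act (s + t) x = act s (act t x) &
      forall i : cidx M,
        smooth_into [set z : 'rV[R]_n * 'rV[R]_m | cimg i z.2]
                    (fun z => act (torus_pi z.1) (cinv i z.2))].

Definition effective : Prop := forall t, (forall x, act t x = x) -> t = 0.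

Definition torus_orbit (p : M) : set M := [set act t p | t in setT].

Definition stabilizer (p : M) : set (torus R n) := [set t | act t p = p].

Definition regular_orbit (p : M) : Prop := finite_set (stabilizer p).

(* The vector field induced by [v], at the point of coordinates [y]. *)
Definition fundamental_field (v : 'rV[R]_n) (i : cidx M) (y : 'rV[R]_m) :
    'rV[R]_m :=
  'D_v (fun s => cmap i (act (torus_pi s) (cinv i y))) 0.

(* The dual of the Lie algebra is the space of column vectors, the value of
   the linear form [xi] on [v] being [v *m xi]. *)
Definition moment_map (w : components M) (mu : M -> 'cV[R]_n) : Prop :=
  [/\ forall i : cidx M, smooth_on (cimg i) (mu \o cinv i),
      forall t x, mu (act t x) = mu x &
      forall (v : 'rV[R]_n) (i : cidx M) (y u : 'rV[R]_m), cimg i y ->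
        'D_u (fun z => (v *m mu (cinv i z)) 0 0) y =
        bil (w i y) (fundamental_field v i y) u].

Definition hamiltonian (w : components M) : Prop :=
  (forall t, preserves (act t) w) /\ exists mu, moment_map w mu.

End TorusAction.

Section MeanCurvature.
Context {R : realType} {k m : nat}.
(* The components of a Riemannian metric in a chart, and an immersion read in
   that chart. *)
Variables (G : 'rV[R]_m -> 'M[R]_m) (F : 'rV[R]_k -> 'rV[R]_m).

Definition christoffel (y : 'rV[R]_m) (c a b : 'I_m) : R :=
  2^-1 * \sum_(d < m) invmx (G y) c d *
    ('D_(basis_vec a) (fun z => G z b d) y +
     'D_(basis_vec b) (fun z => G z a d) y -
     'D_(basis_vec d) (fun z => G z a b) y).

Definition partial (a : 'I_k) (t : 'rV[R]_k) : 'rV[R]_m :=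
  'D_(basis_vec a) F t.

(* nabla_(d_a F) (d_b F) for the Levi-Civita connection nabla. *)
Definition cov_partial (t : 'rV[R]_k) (a b : 'I_k) : 'rV[R]_m :=
  'D_(basis_vec a) (partial b) t +
  \row_(c < m) \sum_(d < m) \sum_(e < m)
    christoffel (F t) c d e * partial a t 0 d * partial b t 0 e.

Definition first_fundamental_form (t : 'rV[R]_k) : 'M[R]_k :=
  \matrix_(a, b) bil (G (F t)) (partial a t) (partial b t).

Definition normal_part (t : 'rV[R]_k) (x : 'rV[R]_m) : 'rV[R]_m :=
  x - \sum_(a < k) \sum_(b < k)
        (invmx (first_fundamental_form t) a b *
         bil (G (F t)) x (partial a t)) *: partial b t.

Definition second_fundamental_form (t : 'rV[R]_k) (a b : 'I_k) : 'rV[R]_m :=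
  normal_part t (cov_partial t a b).

(* Unnormalized: the trace of the second fundamental form. *)
Definition mean_curvature (t : 'rV[R]_k) : 'rV[R]_m :=
  \sum_(a < k) \sum_(b < k)
    invmx (first_fundamental_form t) a b *: second_fundamental_form t a b.

End MeanCurvature.

Section Submanifolds.
Context {R : realType} {m : nat} {M : manifold R m}.

Definition local_parametrization (k : nat) (S : set M)
    (U : set 'rV[R]_k) (f : 'rV[R]_k -> M) : Prop :=
  [/\ open U,
      smooth_into U f,
      forall (t u : 'rV[R]_k) (i : cidx M), U t -> cdom i (f t) ->
        'D_u (cmap i \o f) t = 0 -> u = 0,
      {in U &, injective f} &
      (* f is a homeomorphism from U onto an open subset of S. *)
      forall W : set 'rV[R]_k, open W -> W `<=` U ->
        exists2 O : set M, open O & f @` W = S `&` O].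

(* Embedded k-dimensional submanifolds with vanishing mean curvature, the
   latter being independent of the parametrization chosen near a point. *)
Definition minimal_submanifold (g : components M) (k : nat) (S : set M) :
    Prop :=
  forall p, S p -> exists (U : set 'rV[R]_k) (f : 'rV[R]_k -> M),
    [/\ local_parametrization S U f,
        (f @` U) p &
        forall t (i : cidx M), U t -> cdom i (f t) ->
          mean_curvature (g i) (cmap i \o f) t = 0].

End Submanifolds.

(* Main.v *)
(* In a chart, let A be the matrix whose rows are the fundamental fields X_a of
   the standard basis, and let D be the determinant of the Gram matrix
   A g A^T.  As the torus is abelian and acts by isometries, D is invariant
   under the action, and so is critical along the whole orbit of a point p
   where D^2 is maximal.  The Killing equation gives
   g(sum_ab G^ab nabla_(X_a) X_b, u) = - (1/2) d(log D)(u) for every u, hence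
   the mean curvature of the orbit of p vanishes as soon as D(p) <> 0.

   That D is not identically zero only uses effectiveness.  If D = 0, every
   point x is fixed by a one-parameter subgroup.  By Dirichlet's theorem and
   the local injectivity of the orbit map transversally to its kernel, the Lie
   algebra of the stabilizer of x contains a nonzero integral vector, so x is
   fixed by a nontrivial torsion element.  There are countably many of these,
   so by Baire one of them, t say, fixes an open set.  At a boundary point of
   the interior of its fixed set, the average of the powers of t read in a
   chart has the identity as derivative, is therefore locally injective, and is
   invariant under t; hence t fixes a neighbourhood of that point, and by
   connectedness t acts trivially. *)

From HB Require Import structures.
Require Import Defs.
From mathcomp Require Import all_boot all_order all_algebra.
From mathcomp Require Import generic_quotient ring_quotient archimedean.
From mathcomp Require Import fingroup perm.
From mathcomp Require Import all_classical all_reals all_analysis.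
From mathcomp Require Import ring lra.

Set Implicit Arguments.
Unset Strict Implicit.
Unset Printing Implicit Defensive.

Import Order.TTheory GRing.Theory Num.Theory.
Import numFieldNormedType.Exports.

Local Open Scope classical_set_scope.
Local Open Scope ring_scope.

(** * Calculus *)

Lemma normr_coord_le (R : realType) m n (x : 'M[R]_(m, n)) i j :
  `|x i j| <= `|x|.
Proof.
rewrite [leRHS]/Num.Def.normr/= mx_normrE.
exact: (le_bigmax _ (fun ij : 'I_m * 'I_n => `|x ij.1 ij.2|) (i, j)).
Qed.

Lemma mx_norm_le (R : realType) m n (x : 'M[R]_(m, n)) (e : R) :
  0 <= e -> (forall i j, `|x i j| <= e) -> `|x| <= e.
Proof.
move=> e0 xe; rewrite [leLHS]/Num.Def.normr/= mx_normrE.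
by apply: bigmax_le => // -[i j] _; exact: xe.
Qed.

Section Calculus.
Context {R : realType}.
Implicit Types U V W : normedModType R.

Lemma is_derive_diff V W (f : V -> W) x v :
  differentiable f x -> is_derive x v f ('D_v f x).
Proof. by move=> df; apply: derivableP; exact: diff_derivable. Qed.

Lemma derive_chain U V W (f : U -> V) (g : V -> W) x v :
  differentiable f x -> differentiable g (f x) ->
  'D_v (g \o f) x = 'D_('D_v f x) g (f x).
Proof.
move=> df dg; rewrite (deriveE _ dg) (deriveE _ df).
by rewrite (deriveE _ (differentiable_comp df dg)) diff_comp.
Qed.

Lemma is_derive_comp_lin U V W (f : U -> V) (g : V -> W) x v dv :
  is_derive x v f dv -> differentiable f x -> differentiable g (f x) ->
  is_derive x v (g \o f) ('D_dv g (f x)).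
Proof.
move=> [_ <-] df dg; rewrite -derive_chain//.
by apply: is_derive_diff; exact: differentiable_comp.
Qed.

(** The two difference quotients coincide, since a directional derivative only sees the line through
    [x]. This serves for restrictions to lines, for translations and for partial derivatives on a
    product. *)
Lemma derive_affine U V W (A : U -> V) (f : V -> W) x v w :
  (forall h : R, A (h *: v + x) = h *: w + A x) ->
  'D_v (f \o A) x = 'D_w f (A x).
Proof.
move=> Aaff; rewrite /derive.
suff -> : (fun h : R => h^-1 *: ((f \o A \o shift x) (h *: v) - (f \o A) x)) =
  (fun h : R => h^-1 *: ((f \o shift (A x)) (h *: w) - f (A x))) by [].
by apply/funext => h /=; rewrite Aaff.
Qed.

Lemma derive_line V W (f : V -> W) x v (t : R) :
  'D_1 (fun s : R => f (x + s *: v)) t = 'D_v f (x + t *: v).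
Proof.
apply: (derive_affine (A := fun s : R => x + s *: v)) => h.
by rewrite [h *: 1]mulr1 scalerDl addrCA.
Qed.

Lemma differentiable_line V W (f : V -> W) x v (t : R) :
  differentiable f (x + t *: v) ->
  differentiable (fun s : R => f (x + s *: v)) t.
Proof.
move=> df; apply: (@differentiable_comp _ _ _ _ (fun s : R => x + s *: v) f) => //.
Qed.

Lemma mvt_line V (h : V -> R) x v :
  (forall t : R, 0 <= t <= 1 -> differentiable h (x + t *: v)) ->
  exists2 t : R, 0 < t < 1 & h (x + v) - h x = 'D_v h (x + t *: v).
Proof.
move=> dh; pose f (s : R) := h (x + s *: v).
have df (t : R) : 0 <= t <= 1 -> differentiable f t.
  by move=> /dh; exact: differentiable_line.
have [] := @MVT _ f (fun t : R => 'D_v h (x + t *: v)) 0 1 ltr01.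
- move=> t; rewrite in_itv/= => /andP[t0 t1].
  rewrite -derive_line; apply: is_derive_diff; apply: df.
  by rewrite !ltW.
- apply: derivable_within_continuous => t; rewrite in_itv/= => t01.
  by apply: diff_derivable; exact: df.
by move=> t; rewrite in_itv/= /f scale1r scale0r addr0 subr0 mulr1; exists t.
Qed.

End Calculus.

Section Calculus2.
Context {R : realType}.
Implicit Types U V W : normedModType R.

Lemma derive_basis n W (f : 'rV[R]_n -> W) x v : differentiable f x ->
  'D_v f x = \sum_(k < n) v 0 k *: 'D_(basis_vec k) f x.
Proof.
move=> df; rewrite deriveE// [in LHS](row_sum_delta v) linear_sum.
by apply: eq_bigr => k _; rewrite linearZ/= deriveE.
Qed.

(** Near [a] the derivative of [F - id] is so small that, by the mean value theorem on each
    coordinate, [F x = F y] forces [|y - x| <= |y - x| / 2]. [F'] is a formula for the derivative of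
    [F], valid near [a]. *)
Lemma local_inj n (F : 'rV[R]_n -> 'rV[R]_n) (F' : 'rV[R]_n -> 'rV[R]_n -> 'rV[R]_n) a :
  (\forall x \near a, differentiable F x /\ forall u, 'D_u F x = F' u x) ->
  (forall u, {for a, continuous (F' u)}) ->
  (forall u, F' u a = u) ->
  exists2 r : R, 0 < r &
    forall x y, ball a r x -> ball a r y -> F x = F y -> x = y.
Proof.
move=> dF cF Fa.
(* The [n] coordinate errors, each below [e], then add up to at most half of [|v|]; [n.+1] keeps [e]
   positive when [n = 0]. *)
pose e : R := (2 * n.+1%:R)^-1.
have e0 : 0 < e by rewrite invr_gt0 mulr_gt0.
have near_id : \forall x \near a, forall k : 'I_n,
    `|F' (basis_vec k) x - basis_vec k| < e.
  apply: (@filter_forall _ _ _ (nbhs a)) => k.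
  have /cvgrPdist_lt/(_ _ e0) := cF (basis_vec k).
  by rewrite /= Fa; apply: filterS => x; rewrite distrC.
have [r /= r0 rB] := (nbhs_ballP a _).1 (@filterI _ (nbhs a) _ _ _ dF near_id).
exists r => //; move=> x y xr yr Fxy.
pose v := y - x.
have line (t : R) : 0 <= t <= 1 -> ball a r (x + t *: v).
  move=> /andP[t0 t1]; move: xr yr; rewrite -ball_normE/= => xr yr.
  have -> : a - (x + t *: v) = (1 - t) *: (a - x) + t *: (a - y).
    by apply/rowP => j; rewrite !mxE; ring.
  apply: (le_lt_trans (ler_normD _ _)); rewrite !normrZ.
  rewrite (ger0_norm t0) ger0_norm ?subr_ge0//.
  have [->|tn1] := eqVneq t 1; first by rewrite subrr mul0r add0r mul1r.
  have {}t1 : t < 1 by rewrite lt_neqAle tn1.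
  have : (1 - t) * `|a - x| < (1 - t) * r by rewrite ltr_pM2l ?subr_gt0.
  have : t * `|a - y| <= t * r by rewrite ler_wpM2l// ltW.
  by rewrite -[X in _ -> _ -> _ < X]mul1r; lra.
have bound j : `|v 0 j| <= `|v| / 2.
  pose h z := F z 0 j - z 0 j.
  have dh z : differentiable F z -> is_derive z v h (('D_v F z - v) 0 j).
    move=> dFz; have Fd : derivable (fun z => F z - z) z v.
      by apply: derivableB; [exact: diff_derivable|exact: derivable_id].
    apply: DeriveDef; first by move/derivable_mxP : Fd => /(_ 0 j); rewrite /h;
       under eq_fun do rewrite !mxE.
    have := derive_mx Fd.
    rewrite deriveB; [|exact: diff_derivable|exact: derivable_id].
    rewrite derive_id.
    by move=> ->; rewrite mxE; congr ('D_v _ z); apply/funext => w; rewrite !mxE.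
  have dfh z : differentiable F z -> differentiable h z.
    move=> dFz; apply: differentiableB => //.
      by apply: (@differentiable_comp _ _ _ _ F (fun M : 'rV_n => M 0 j)) => //;
        exact: differentiable_coord.
    exact: differentiable_coord.
  have [t t01] := @mvt_line R _ h x v (fun t t01 => dfh _ (rB _ (line t t01)).1.1).
  have t01' : 0 <= t <= 1 by case/andP: t01 => ? ?; rewrite !ltW.
  have [[dz F'E] nz] := rB _ (line t t01').
  set z := x + t *: v in dz F'E nz *.
  have -> : x + v = y by rewrite /v addrC subrK.
  rewrite {1 2}/h Fxy (@derive_val _ _ _ _ _ _ _ (dh _ dz)).
  have -> : F y 0 j - y 0 j - (F y 0 j - x 0 j) = - v 0 j by rewrite !mxE; ring.
  move=> /(congr1 (fun x => `|x|)); rewrite normrN => ->.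
  have -> : 'D_v F z - v =
      \sum_(k < n) v 0 k *: (F' (basis_vec k) z - basis_vec k).
    rewrite (derive_basis _ dz) [X in _ - X](row_sum_delta v) -sumrB.
    by apply: eq_bigr => k _; rewrite scalerBr F'E.
  rewrite summxE; apply: (le_trans (ler_norm_sum _ _ _)).
  apply: (@le_trans _ _ (\sum_(k < n) `|v| * e)).
    apply: ler_sum => k _; rewrite mxE normrM ler_pM//.
      exact: normr_coord_le.
    by apply: (le_trans (normr_coord_le _ _ _)) (ltW (nz k)).
  rewrite sumr_const card_ord -[leLHS]mulr_natr -mulrA ler_wpM2l// /e.
  by rewrite invfM -mulrA ler_piMr// mulrC ler_pdivrMr// mul1r ler_nat.
have : `|v| <= `|v| / 2.
  by apply: mx_norm_le => [|i j]; rewrite ?ord1// mulr_ge0.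
have := normr_ge0 v => v0 v2.
have : `|v| = 0 by lra.
by move/normr0_eq0/subr0_eq.
Qed.

End Calculus2.

(** * Symmetry of second derivatives *)

Section Schwarz.
Context {R : realType}.
Implicit Types V W : normedModType R.

(** The mean value theorem is applied twice: along [h *: p] to the increment of [f] by [h *: q],
    then along [h *: q] to [fp]. *)
Lemma second_difference V (f fp : V -> R) (P : set V) x p q (h : R) :
  0 < h ->
  (forall a b : R, 0 <= a <= h -> 0 <= b <= h -> P (x + a *: p + b *: q)) ->
  (forall z, P z -> differentiable f z) ->
  (forall z, P z -> 'D_p f z = fp z) ->
  (forall z, P z -> differentiable fp z) ->
  exists2 z, P z & f (x + h *: p + h *: q) - f (x + h *: p) - f (x + h *: q) + f x =
    h ^+ 2 * 'D_q fp z.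
Proof.
move=> h0 Px df fpE ddf.
have hs (t : R) : 0 <= t <= 1 -> 0 <= t * h <= h.
  by move=> /andP[t0 t1]; rewrite mulr_ge0 ?(ltW h0)//= ler_piMl// ltW.
have lt_le (t : R) : 0 < t < 1 -> 0 <= t <= 1.
  by move=> /andP[? ?]; rewrite !ltW.
have h00 : (0 : R) <= 0 <= h by rewrite lexx ltW.
have hhh : 0 <= h <= h by rewrite lexx ltW.
pose phi z := f (z + h *: q) - f z.
have dfq z : differentiable f (z + h *: q) ->
    differentiable (fun z => f (z + h *: q)) z.
  by move=> dz; apply: (@differentiable_comp _ _ _ _ (fun z => z + h *: q) f).
have Pt (t b : R) : 0 <= t <= 1 -> 0 <= b <= h ->
    P (x + t *: (h *: p) + b *: q).
  by move=> /hs th bh; rewrite scalerA; exact: Px.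
have Pt0 (t : R) : 0 <= t <= 1 -> P (x + t *: (h *: p)).
  by move=> t01; have := Pt t 0 t01 h00; rewrite scale0r addr0.
have dft t b t01 bh := df _ (Pt t b t01 bh).
have dft0 t t01 := df _ (Pt0 t t01).
have dphi (t : R) : 0 <= t <= 1 -> differentiable phi (x + t *: (h *: p)).
  move=> t01; apply: differentiableB; last exact: dft0.
  by apply: dfq; exact: dft.
have [t /lt_le t01] := @mvt_line R _ phi x (h *: p) dphi.
have th := hs _ t01.
rewrite deriveB; [|exact/diff_derivable/dfq/dft|exact/diff_derivable/dft0].
rewrite (derive_affine (A := fun z => z + h *: q) f (w := h *: p)) => [|r]; last first.
  by rewrite -!addrA.
have Dh z : P z -> 'D_(h *: p) f z = h * fp z.
  by move=> Pz; rewrite -fpE// (deriveE _ (df _ Pz)) linearZ/= -deriveE//; exact: df.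
rewrite !Dh; [|exact: Pt0|exact: Pt].
set y := x + t *: (h *: p).
have ddy (s : R) : 0 <= s <= 1 -> differentiable fp (y + s *: (h *: q)).
  by move=> /hs sh; apply: ddf; rewrite /y !scalerA; exact: Px.
have [s /lt_le s01] := @mvt_line R _ fp y (h *: q) ddy.
have Pz : P (y + s *: (h *: q)) by rewrite /y !scalerA; apply: Px; exact: hs.
rewrite -mulrBr => E phiE; exists (y + s *: (h *: q)) => //.
have DE : 'D_(h *: q) fp (y + s *: (h *: q)) =
          h * 'D_q fp (y + s *: (h *: q)).
  by rewrite (deriveE _ (ddy _ s01)) (deriveE q (ddy _ s01)) linearZ.
by rewrite expr2 -mulrA -DE -E -phiE /phi opprB [f x - _]addrC addrA.
Qed.

Lemma distr_lt_half (a b c d : R) :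
  `|a - c| < d -> `|b - c| < d -> `|a - b| < 2 * d.
Proof. by rewrite !ltr_norml => /andP[? ?] /andP[? ?]; apply/andP; split; lra. Qed.

(** The second difference is symmetric in [p] and [q], so on a small parallelogram the two mixed
    derivatives take a common value, at possibly different points; continuity then forces equality
    at [x]. *)
Lemma schwarz V (f fp fq : V -> R) x p q :
  (\forall z \near x, differentiable f z) ->
  (\forall z \near x, 'D_p f z = fp z /\ differentiable fp z) ->
  (\forall z \near x, 'D_q f z = fq z /\ differentiable fq z) ->
  {for x, continuous ('D_q fp)} -> {for x, continuous ('D_p fq)} ->
  'D_q fp x = 'D_p fq x.
Proof.
move=> df dpf dqf cqp cpq; apply/eqP/negP => /negP neq.
pose e := `|'D_q fp x - 'D_p fq x| / 2.
have e2 : 2 * e = `|'D_q fp x - 'D_p fq x|.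
  by rewrite /e; move: `|_| => D; field.
have e0 : 0 < e by rewrite divr_gt0// normr_gt0 subr_eq0.
have nqp : \forall z \near x, `|'D_q fp x - 'D_q fp z| < e.
  by have /cvgrPdist_lt/(_ _ e0) := cqp.
have npq : \forall z \near x, `|'D_p fq x - 'D_p fq z| < e.
  by have /cvgrPdist_lt/(_ _ e0) := cpq.
have [r /= r0 rB] := (nbhs_ballP x _).1
  (filterI df (filterI (filterI dpf dqf) (filterI nqp npq))).
(* This size keeps the parallelogram inside the ball of radius [r]; the added 1 covers
   [p = q = 0]. *)
pose h := r / (`|p| + `|q| + 1).
have D0 : 0 < `|p| + `|q| + 1 by rewrite ltr_wpDl// addr_ge0.
have h0 : 0 < h by rewrite divr_gt0.
have Px (a b : R) : 0 <= a <= h -> 0 <= b <= h ->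
    ball x r (x + a *: p + b *: q).
  move=> /andP[a0 ah] /andP[b0 bh]; rewrite -ball_normE/= -addrA opprD addNKr.
  rewrite normrN (le_lt_trans (ler_normD _ _))// !normrZ !ger0_norm//.
  apply: (@le_lt_trans _ _ (h * (`|p| + `|q|))).
    by rewrite mulrDr lerD// ler_wpM2r.
  by rewrite /h mulrAC ltr_pdivrMr// ltr_pM2l// ltrDl.
have [z zr E1] := second_difference h0 Px (fun z zr => (rB z zr).1)
  (fun z zr => (rB z zr).2.1.1.1) (fun z zr => (rB z zr).2.1.1.2).
have [|y yr E2] := @second_difference V f fq (ball x r) x q p h h0 _
    (fun z zr => (rB z zr).1) (fun z zr => (rB z zr).2.1.2.1)
    (fun z zr => (rB z zr).2.1.2.2).
  by move=> a b ah bh; rewrite addrAC; exact: Px.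
have E : 'D_q fp z = 'D_p fq y.
  apply: (@mulfI _ (h ^+ 2)); first by rewrite expf_neq0// gt_eqF.
  rewrite -E1 -E2 [x + h *: q + _]addrAC.
  apply: (congr1 (fun u => u + f x)).
  by rewrite [LHS]addrAC.
have := (rB z zr).2.2.1; have := (rB y yr).2.2.2; rewrite /= -E => Hy Hz.
by have := distr_lt_half Hz Hy; rewrite e2 ltxx.
Qed.

End Schwarz.

(** On the line through [x] along [u] the square has a maximum, so [2 h h' = 0] there, and the
    nonzero value [h x] can be divided out. *)
Lemma derive_sqr_at_max (R : realType) (V : normedModType R) (h : V -> R) x u :
  (\forall z \near x, forall v, derivable h z v) ->
  (\forall z \near x, h z ^+ 2 <= h x ^+ 2) -> h x != 0 -> 'D_u h x = 0.
Proof.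
move=> dh hmax hx0.
have [r /= r0 rB] := (nbhs_ballP x _).1 (filterI dh hmax).
pose e := r / (`|u| + 1).
have u1 : 0 < `|u| + 1 by rewrite ltr_wpDl.
have e0 : 0 < e by rewrite divr_gt0.
have inB (c : R) : c \in `](- e), e[%R -> ball x r (x + c *: u).
  rewrite in_itv/= -ltr_norml => ce; rewrite -ball_normE/= opprD addNKr normrN normrZ.
  rewrite (@le_lt_trans _ _ (`|c| * (`|u| + 1)))//.
    by rewrite ler_wpM2l// lerDl.
  by rewrite -ltr_pdivlMr.
pose k (c : R) := h (x + c *: u).
have dk (c : R) : c \in `](- e), e[%R -> derivable k c 1.
  move=> /inB/rB[dhc _]; apply/derivable1P.
  have -> : (fun s : R => k (s *: (1 : R) + c)) = (fun s => h (s *: u + (x + c *: u))).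
    by apply/funext => s; rewrite /k [s *: 1]mulr1 scalerDl addrCA.
  exact: ((derivable1P h (x + c *: u) u).1 (dhc u)).
have e00 : 0 \in `](- e), e[%R by rewrite in_itv/= oppr_lt0 e0.
have dk2 (c : R) : c \in `](- e), e[%R -> derivable (k ^+ 2) c 1.
  by move=> /dk; exact: derivableX.
have kmax (c : R) : c \in `](- e), e[%R -> (k ^+ 2) c <= (k ^+ 2) 0.
  by move=> /inB/rB[_ /= hc]; rewrite !fctE /k scale0r addr0.
have ee : - e <= e by rewrite ge0_cp ?ltW.
have /@derive_val := derive1_at_max ee dk2 e00 kmax.
rewrite deriveX; last exact: dk.
rewrite /k derive_line scale0r addr0 /= expr1 => /eqP.
by rewrite scaler_eq0 mulf_eq0 pnatr_eq0 (negbTE hx0)/= => /eqP.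
Qed.

(** * Matrix-valued functions *)

Section MatrixCalculus.
Context {R : realType}.
Implicit Types U V W : normedModType R.

Lemma bilE k (B : 'M[R]_k) u v :
  bil B u v = \sum_(a < k) \sum_(b < k) u 0 a * B a b * v 0 b.
Proof.
rewrite /bil !mxE exchange_big/=; apply: eq_bigr => b _.
by rewrite !mxE mulr_suml.
Qed.

Lemma is_derive_entry V m n (M : V -> 'M[R]_(m, n)) x v dM i j :
  is_derive x v M dM -> is_derive x v (fun t => M t i j) (dM i j).
Proof.
move=> [dm <-]; apply: DeriveDef; first by move/derivable_mxP : dm.
by rewrite (derive_mx dm) mxE.
Qed.

Lemma is_derive_mx V m n (M : V -> 'M[R]_(m, n)) x v (dM : 'M[R]_(m, n)) :
  (forall i j, is_derive x v (fun t => M t i j) (dM i j)) ->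
  is_derive x v M dM.
Proof.
move=> h; have dm : derivable M x v by apply/derivable_mxP => i j.
by apply: DeriveDef => //; rewrite derive_mx//; apply/matrixP => i j; rewrite mxE derive_val.
Qed.

Lemma is_derive_bigsum V W (I : Type) (r : seq I) (P : pred I)
    (f : I -> V -> W) x v (df : I -> W) :
  (forall i, P i -> is_derive x v (f i) (df i)) ->
  is_derive x v (fun t => \sum_(i <- r | P i) f i t) (\sum_(i <- r | P i) df i).
Proof.
move=> h; rewrite (_ : (fun t => _) = \sum_(i <- r | P i) f i); last first.
  by apply/funext => t; rewrite fct_sumE.
by elim/big_ind2 : _ => // [|] *; [exact: is_derive_cst|exact: is_deriveD].
Qed.

Lemma is_derive_mulmxl V m n p (A : 'M[R]_(m, n)) (M : V -> 'M[R]_(n, p)) x v dM :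
  is_derive x v M dM -> is_derive x v (fun t => A *m M t) (A *m dM).
Proof.
move=> h; apply: is_derive_mx => i j; rewrite !mxE.
rewrite (_ : (fun t => _) = (fun t => \sum_k A i k * M t k j)); last first.
  by apply/funext => t; rewrite mxE.
apply: is_derive_bigsum => k _.
have hk := is_derive_entry k j h.
exact: (is_deriveZ (f := fun t => M t k j) (A i k)).
Qed.

Lemma is_derive_mulmxr V m n p (A : 'M[R]_(n, p)) (M : V -> 'M[R]_(m, n)) x v dM :
  is_derive x v M dM -> is_derive x v (fun t => M t *m A) (dM *m A).
Proof.
move=> h; apply: is_derive_mx => i j; rewrite !mxE.
rewrite (_ : (fun t => _) = (fun t => \sum_k M t i k * A k j)); last first.
  by apply/funext => t; rewrite mxE.
apply: is_derive_bigsum => k _; rewrite mulrC.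
rewrite (_ : (fun t => _) = A k j *: (fun t => M t i k)).
  by have hk := is_derive_entry i k h; exact: is_deriveZ.
by apply/funext => t; rewrite mulrC.
Qed.

Lemma differentiable_mulmxr m n (A : 'M[R]_(m, n)) u :
  differentiable (fun u : 'rV[R]_m => u *m A) u.
Proof.
rewrite (_ : (fun u => _) = \sum_(k < m) (fun u : 'rV[R]_m => u 0 k *: row k A)).
  apply: differentiable_sum => k; apply: differentiableZl.
  exact: differentiable_coord.
by apply/funext => w; rewrite mulmx_sum_row fct_sumE.
Qed.

Lemma is_derive_bil V k (G : V -> 'M[R]_k) (f g : V -> 'rV[R]_k) x v dG df dg :
  is_derive x v G dG -> is_derive x v f df -> is_derive x v g dg ->
  is_derive x v (fun t => bil (G t) (f t) (g t))
    (bil dG (f x) (g x) + bil (G x) df (g x) + bil (G x) (f x) dg).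
Proof.
move=> hG hf hg.
rewrite (_ : (fun t => _) = \sum_(a < k) \sum_(b < k)
    ((fun t => f t 0 a) * (fun t => G t a b) * (fun t => g t 0 b))); last first.
  apply/funext => t; rewrite bilE fct_sumE; apply: eq_bigr => a _.
  by rewrite fct_sumE.
have Hf a := is_derive_entry 0 a hf.
have Hg a := is_derive_entry 0 a hg.
have HG a b := is_derive_entry a b hG.
apply: is_derive_eq; rewrite !bilE -!big_split/=; apply: eq_bigr => a _.
rewrite -!big_split/=; apply: eq_bigr => b _.
by rewrite !fctE /GRing.scale/=; ring.
Qed.

Lemma is_derive_prod V n (f : 'I_n -> V -> R) x v (df : 'I_n -> R) :
  (forall i, is_derive x v (f i) (df i)) ->
  is_derive x v (fun t => \prod_i f i t)
    (\sum_i df i * \prod_(j | j != i) f j x).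
Proof.
elim: n f df => [|n IH] f df hf.
  rewrite big_ord0 (_ : (fun t => _) = cst 1); first exact: is_derive_cst.
  by apply/funext => t; rewrite big_ord0.
have {}IH := IH _ _ (fun i => hf (lift ord0 i)).
rewrite (_ : (fun t => _) =
    f ord0 * (fun t => \prod_i f (lift ord0 i) t)); last first.
  by apply/funext => t; rewrite big_ord_recl.
apply: is_derive_eq; rewrite big_ord_recl /GRing.scale/= addrC; congr (_ + _).
  by rewrite mulrC [in RHS]big_mkcond/= big_ord_recl mul1r.
rewrite mulr_sumr; apply: eq_bigr => i _.
rewrite big_mkcond/= [in RHS]big_mkcond/= big_ord_recl/= mulrCA; do 2 congr (_ * _).
Qed.

(** In the Leibniz formula a permutation other than the identity moves at least two indices, so its
    products with one factor differentiated still contain an off-diagonal entry of [1%:M]; only the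
    identity permutation contributes. *)
Lemma is_derive_det1 V n (M : V -> 'M[R]_n) x v dM :
  is_derive x v M dM -> M x = 1%:M ->
  is_derive x v (fun t => \det (M t)) (\tr dM).
Proof.
move=> hM M1.
have -> : \tr dM = \sum_(s : 'S_n) (-1) ^+ s *
    \sum_k dM k (s k) * \prod_(j | j != k) M x j (s j).
  rewrite (bigD1 1%g)//= odd_perm1 expr0 mul1r [X in _ + X]big1 ?addr0.
    apply: eq_bigr => k _; rewrite perm1 big1 ?mulr1// => j _.
    by rewrite perm1 M1 mxE eqxx.
  move=> s s1; rewrite big1 ?mulr0// => k _.
  (* If [s] moved only [k], it would fix [s k], and injectivity would give [s k = k]. *)
  suff [j jk sj] : exists2 j, j != k & s j != j.
    by rewrite (bigD1 j)//= M1 mxE eq_sym (negbTE sj) mul0r mulr0.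
  apply: contraPP s1 => nj; apply/negP; rewrite negbK; apply/eqP/permP => j.
  have fixj i : i != k -> s i = i.
    by move=> ik; apply/eqP/negPn/negP => si; apply: nj; exists i.
  rewrite perm1; have [->|/fixj//] := eqVneq j k.
  apply/eqP/negPn/negP => sk.
  by move/fixj/perm_inj/eqP : (sk); rewrite (negbTE sk).
apply: is_derive_bigsum => s _.
apply: (is_deriveZ (f := fun t => \prod_k M t k (s k))).
by apply: is_derive_prod => k; exact: is_derive_entry.
Qed.

(** Jacobi's formula: factoring out [M x] moves the base point to the identity matrix. *)
Lemma is_derive_det V n (M : V -> 'M[R]_n) x v dM :
  is_derive x v M dM -> M x \in unitmx ->
  is_derive x v (fun t => \det (M t)) (\det (M x) * \tr (invmx (M x) *m dM)).
Proof.
move=> hM Mu.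
rewrite (_ : (fun t => _) = fun t => \det (M x) * \det (invmx (M x) *m M t)).
  apply: (is_deriveZ (f := fun t => \det (invmx (M x) *m M t))).
  by apply: is_derive_det1; [exact: is_derive_mulmxl|rewrite mulVmx].
by apply/funext => t; rewrite -det_mulmx mulmxA mulmxV// mul1mx.
Qed.

End MatrixCalculus.

Lemma continuous_mx (R : realType) (T : topologicalType) m n (f : T -> 'M[R]_(m, n)) x i j :
  {for x, continuous f} -> {for x, continuous (fun t => f t i j)}.
Proof.
move=> cf; apply: (@continuous_comp _ _ _ f (fun M : 'M[R]_(m, n) => M i j)) => //.
exact: coord_continuous.
Qed.

Lemma continuous_det (R : realType) (T : topologicalType) n (M : T -> 'M[R]_n) x :
  (forall i j, {for x, continuous (fun t => M t i j)}) ->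
  {for x, continuous (fun t => \det (M t))}.
Proof.
move=> cM; apply: (cvg_big (op := +%R)) => [|s _]; first exact: add_continuous.
apply: cvgM; first exact: cvg_cst.
apply: (@cvg_big R _ *%R 1 xpredT _ _ (nbhs x) _
  (fun k t => M t k (s k)) (fun k => M x k (s k))) => [|k _]; last exact: cM.
exact: mul_continuous.
Qed.

(** This serves [derive_sqr_at_max], which asks for derivability at all nearby points, where the
    matrix is not known to be invertible. *)
Lemma derivable_det (R : realType) (V : normedModType R) n (M : V -> 'M[R]_n) x v :
  derivable M x v -> derivable (fun t => \det (M t)) x v.
Proof.
move=> /derivable_mxP dM.
have hM i j : is_derive x v (fun t => M t i j) ('D_v (fun t => M t i j) x).
  exact: derivableP.
have hs (s : 'S_n) :
    is_derive x v (fun t => (-1) ^+ s * \prod_k M t k (s k)) ((-1) ^+ s *: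
    \sum_i 'D_v (fun t => M t i (s i)) x * \prod_(j | j != i) M x j (s j)).
  apply: (is_deriveZ (f := fun t => \prod_k M t k (s k))).
  exact: is_derive_prod.
by have [] := is_derive_bigsum (index_enum _) (fun s (_ : true) => hs s).
Qed.

Lemma continuous_bil (R : realType) (T : topologicalType) k (G : T -> 'M[R]_k)
    (f g : T -> 'rV[R]_k) x :
  {for x, continuous G} -> {for x, continuous f} -> {for x, continuous g} ->
  {for x, continuous (fun t => bil (G t) (f t) (g t))}.
Proof.
move=> cG cf cg.
rewrite (_ : (fun t => _) = fun t => \sum_a \sum_b f t 0 a * G t a b * g t 0 b).
  apply: (@cvg_big R _ +%R 0 xpredT _ _ (nbhs x) _
    (fun a t => \sum_b f t 0 a * G t a b * g t 0 b)) => [|a _].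
    exact: add_continuous.
  apply: (@cvg_big R _ +%R 0 xpredT _ _ (nbhs x) _
    (fun b t => f t 0 a * G t a b * g t 0 b)) => [|b _].
    exact: add_continuous.
  by apply: cvgM; [apply: cvgM|]; exact: continuous_mx.
by apply/funext => t; rewrite bilE.
Qed.

(** * Smooth functions *)

Section Smooth.
Context {R : realType}.
Implicit Types U V W : normedModType R.

Lemma smooth_on_differentiable V W (D : set V) (f : V -> W) x :
  smooth_on D f -> D x -> differentiable f x.
Proof. by move=> /(_ 1%N)[df _] Dx; exact: (df x (mem_set Dx)). Qed.

Lemma smooth_on_derive V W (D : set V) (f : V -> W) v :
  smooth_on D f -> smooth_on D ('D_v f).
Proof. by move=> sf k; have [_] := sf k.+1; exact. Qed.

Lemma smooth_on_continuous V W (D : set V) (f : V -> W) x :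
  smooth_on D f -> D x -> {for x, continuous f}.
Proof. by move=> /(_ 0%N) cf Dx; exact: (cf x (mem_set Dx)). Qed.

(** [B] is the linear part of [A]. The derivative of [f \o A] along [v] is ['D_(B v) f \o A], of the
    same shape again, so the induction on the order closes. *)
Lemma smooth_on_affine U V W (D : set U) (E : set V) (A : U -> V) (B : U -> V)
    (f : V -> W) :
  (forall x v (h : R), A (h *: v + x) = h *: B v + A x) ->
  (forall x, differentiable A x) -> D `<=` A @^-1` E ->
  smooth_on E f -> smooth_on D (f \o A).
Proof.
move=> AB dA DE sf k; elim: k f sf => [|k IH] f sf.
  move=> x /set_mem/DE Ex; apply: continuous_comp.
    exact: differentiable_continuous.
  exact: (smooth_on_continuous sf).
split=> [x|v].
  move=> /set_mem/DE Ex; apply: differentiable_comp => //.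
  exact: (smooth_on_differentiable sf).
rewrite (_ : (fun x => _) = 'D_(B v) f \o A); last first.
  by apply/funext => x; apply: derive_affine => h; exact: AB.
by apply: IH; exact: smooth_on_derive.
Qed.

Lemma smooth_on_schwarz V m n (D : set V) (f : V -> 'M[R]_(m, n)) x p q :
  open D -> smooth_on D f -> D x -> 'D_q ('D_p f) x = 'D_p ('D_q f) x.
Proof.
move=> oD sf Dx.
have Dn : \forall z \near x, D z by exact: open_nbhs_nbhs.
have entry (g : V -> 'M[R]_(m, n)) z v i j : smooth_on D g -> D z ->
    'D_v (fun t => g t i j) z = 'D_v g z i j.
  by move=> sg Dz; rewrite (derive_mx (diff_derivable (smooth_on_differentiable sg Dz))) mxE.
have diffe (g : V -> 'M[R]_(m, n)) z i j : smooth_on D g -> D z ->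
    differentiable (fun t => g t i j) z.
  move=> sg Dz; apply: (@differentiable_comp _ _ _ _ g (fun M : 'M[R]_(m, n) => M i j)).
    exact: (smooth_on_differentiable sg).
  exact: differentiable_coord.
have conte (g : V -> 'M[R]_(m, n)) v i j : smooth_on D g ->
    {for x, continuous ('D_v (fun t => g t i j))}.
  move=> sg; have : {for x, continuous (fun t => 'D_v g t i j)}.
    by apply: continuous_mx; apply: (smooth_on_continuous _ Dx); exact: smooth_on_derive.
  move=> c; rewrite /prop_for /continuous_at/= (entry _ _ _ _ _ sg Dx).
  apply: cvg_trans c; apply: near_eq_cvg; apply: filterS Dn => z Dz.
  by rewrite entry.
have sp := smooth_on_derive p sf; have sq := smooth_on_derive q sf.
apply/(@matrixP R m n _ _) => i j.
apply: (etrans (esym (entry _ _ q i j sp Dx))).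
apply: (etrans _ (entry _ _ p i j sq Dx)).
apply: (@schwarz R V (fun t => f t i j)).
- by apply: filterS Dn => z Dz; exact: diffe.
- by apply: filterS Dn => z Dz; split; [exact: entry|exact: diffe].
- by apply: filterS Dn => z Dz; split; [exact: entry|exact: diffe].
- exact: conte.
- exact: conte.
Qed.

End Smooth.

Lemma open_preimage (T U : topologicalType) (D : set T) (E : set U) (f : T -> U) :
  open D -> {in D, continuous f} -> open E -> open (D `&` f @^-1` E).
Proof.
move=> oD cf oE; rewrite openE => x [Dx Ex]; rewrite /interior /=.
apply: filterI; first exact: open_nbhs_nbhs.
by apply: (cf x); [exact: mem_set|exact: open_nbhs_nbhs].
Qed.

(** * Integral vectors and the torus *)

Section TorusArithmetic.
Context {R : realType} {n : nat}.
Implicit Types s t z v : 'rV[R]_n.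

Lemma torus_piD s t : torus_pi (s + t) = torus_pi s + torus_pi t.
Proof. by rewrite /torus_pi !piE. Qed.

Lemma torus_pi0 : torus_pi (0 : 'rV[R]_n) = 0.
Proof. by rewrite /torus_pi !piE. Qed.

Lemma torus_piN s : torus_pi (- s) = - torus_pi s.
Proof. by rewrite /torus_pi !piE. Qed.

Lemma torus_piMn s k : torus_pi (s *+ k) = torus_pi s *+ k.
Proof.
by elim: k => [|k IH]; rewrite ?mulr0n ?torus_pi0// !mulrS torus_piD IH.
Qed.

Lemma torus_pi_surj (t : torus R n) : exists s, torus_pi s = t.
Proof. by exists (generic_quotient.repr t); rewrite /torus_pi reprK. Qed.

Lemma torus_pi_eq0 s : (torus_pi s == 0) = integral_vec s.
Proof.
by rewrite -torus_pi0 /torus_pi -Quotient.idealrBE subr0.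
Qed.

(** The unit cube is cut into [N.+1 ^ n] small cubes; this is the index of the one that contains the
    vector of fractional parts of [s]. *)
Definition cell (N : nat) s : {ffun 'I_n -> 'I_N.+1} :=
  [ffun k => inord (Num.truncn (N.+1%:R * (s 0 k - (Num.floor (s 0 k))%:~R)))].

(** The witness is the difference of the integer parts; what remains compares two vectors of
    fractional parts in the same small cube. *)
Lemma cell_close N s t : cell N s = cell N t ->
  exists2 z, integral_vec z & `|s - t - z| <= N.+1%:R^-1.
Proof.
move=> st; pose f (x : R) : R := (Num.floor x)%:~R.
exists (\row_k (f (s 0 k) - f (t 0 k))).
  by apply/mxOverP => i k; rewrite mxE rpredB// rpred_int.
apply: mx_norm_le => [|i k]; first by rewrite invr_ge0.
rewrite ord1 !mxE.
have fb (x : R) : let y := N.+1%:R * (x - f x) in 0 <= y /\ (Num.truncn y < N.+1)%N.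
  have /andP[x0 x1] := floor_itv x.
  have y0 : 0 <= N.+1%:R * (x - f x) by rewrite mulr_ge0// subr_ge0.
  split=> //; rewrite truncn_lt_nat// -[ltRHS]mulr1 ltr_pM2l//.
  by rewrite ltrBlDl; move: x1; rewrite intrD.
have [x0 xN] := fb (s 0 k); have [y0 yN] := fb (t 0 k).
have /(congr1 val) : cell N s k = cell N t k by rewrite st.
rewrite !ffunE /= !inordK// => E.
have /andP[x1 x2] := truncn_itv x0; have /andP[y1 y2] := truncn_itv y0.
rewrite -E in y1 y2.
have -> : s 0 k - t 0 k - (f (s 0 k) - f (t 0 k)) =
    (s 0 k - f (s 0 k)) - (t 0 k - f (t 0 k)) by ring.
rewrite -[leRHS]mul1r ler_pdivlMr// mulrC -[X in X * `|_|]ger0_norm// -normrM.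
rewrite mulrBr; move: x1 x2 y1 y2 {x0 y0 xN yN E fb}.
move: (N.+1%:R * (s 0 k - _)) (N.+1%:R * (t 0 k - _)) (Num.truncn _) => a b c.
rewrite -natr1 => *; rewrite ler_norml; apply/andP; split; lra.
Qed.

(** Pigeonhole on the multiples of [u], a vector of norm 2 along [v]: two of them lie in the same
    cell modulo the lattice. Distinct multiples are at least 2 apart, while [N.+1%:R^-1] is less
    than 2, so [z] cannot vanish. *)
Lemma dirichlet v (e : R) : v != 0 -> 0 < e ->
  exists (t : R) (z : 'rV[R]_n), [/\ integral_vec z, z != 0 & `|t *: v - z| < e].
Proof.
move=> v0 e0; have nv0 : 0 < `|v| by rewrite normr_gt0.
pose N := Num.truncn (Num.max e^-1 1).
have Ne : N.+1%:R^-1 < e /\ (N.+1%:R^-1 : R) < 2.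
  have : Num.max e^-1 1 < N.+1%:R by exact: truncnS_gt.
  rewrite gt_max => /andP[Ne N1]; split.
    by rewrite invf_plt ?posrE.
  by rewrite (@lt_trans _ _ 1)// ?ltr1n// invf_lt1.
pose u := (2 / `|v|) *: v.
have nu : `|u| = 2 by rewrite normrZ ger0_norm ?divr_ge0// divfK// gt_eqF.
pose K := #|{ffun 'I_n -> 'I_N.+1}|.+1.
have /injectivePn[i [j ij cij]] : ~~ injectiveb (fun i : 'I_K => cell N (i%:R *: u)).
  apply/negP => /injectiveP /leq_card; rewrite card_ord /K.
  by rewrite ltnn.
have [z zi zN] := cell_close cij.
exists ((i%:R - j%:R) * (2 / `|v|)), z.
have E : ((i%:R - j%:R) * (2 / `|v|)) *: v = i%:R *: u - j%:R *: u.
  by rewrite -scalerA scalerBl.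
rewrite E; split => //; last by rewrite (le_lt_trans zN)//; case: Ne.
apply: contraTneq zN => ->; rewrite subr0 -scalerBl normrZ nu -ltNge.
rewrite (lt_le_trans Ne.2)// ler_peMl//.
have -> : `|i%:R - j%:R : R| = `|i%:Z - j%:Z|%:~R by rewrite intr_norm rmorphB.
by rewrite ler1z -gtz0_ge1 normr_gt0 subr_eq0.
Qed.

End TorusArithmetic.

(** * Actions in charts *)

Section Charts.
Context {R : realType} {m : nat} {M : manifold R m}.

Lemma cimg_cmap (i : cidx M) x : cdom i x -> cimg i (cmap i x).
Proof. by move=> ix; exists x. Qed.

Lemma cdomK (i : cidx M) x : cdom i x -> cinv i (cmap i x) = x.
Proof. by move=> ix; apply: cmapK; exact: mem_set. Qed.

Lemma cdom_cinv (i : cidx M) y : cimg i y -> cdom i (cinv i y).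
Proof. by move=> [x ix <-]; rewrite cdomK. Qed.

Lemma cimgK (i : cidx M) y : cimg i y -> cmap i (cinv i y) = y.
Proof. by move=> [x ix <-]; rewrite cdomK. Qed.

Lemma open_cimg (i : cidx M) : open (cimg i).
Proof. exact: cimg_open. Qed.

Lemma near_cdom (i : cidx M) x : cdom i x -> \forall z \near x, cdom i z.
Proof. by move=> ix; apply: open_nbhs_nbhs; split=> //; exact: cdom_open. Qed.

Lemma near_cimg (i : cidx M) y : cimg i y -> \forall z \near y, cimg i z.
Proof. by move=> iy; apply: open_nbhs_nbhs; split=> //; exact: open_cimg. Qed.

Lemma continuous_cmap (i : cidx M) x : cdom i x -> {for x, continuous (cmap i)}.
Proof. by move=> ix; apply: cmap_continuous; exact: mem_set. Qed.

Lemma continuous_cinv (i : cidx M) y : cimg i y -> {for y, continuous (cinv i)}.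
Proof. by move=> iy; apply: cinv_continuous; exact: mem_set. Qed.

End Charts.

Section Action.
Context {R : realType} {n m : nat} {M : manifold R m}.
Variable act : torus R n -> M -> M.
Hypothesis act_smooth : smooth_action act.

Local Notation field := (fundamental_field act).

Definition act_in (i j : cidx M) (z : 'rV[R]_n * 'rV[R]_m) : 'rV[R]_m :=
  cmap j (act (torus_pi z.1) (cinv i z.2)).

(** The intersection has the shape of the set in [smooth_into], so the smoothness of the action
    applies to it as is. *)
Definition act_dom (i j : cidx M) : set ('rV[R]_n * 'rV[R]_m) :=
  [set z | cimg i z.2] `&` [set z | cdom j (act (torus_pi z.1) (cinv i z.2))].

Lemma act0 x : act 0 x = x.
Proof. by case: act_smooth. Qed.

Lemma actD s t x : act (s + t) x = act s (act t x).
Proof. by case: act_smooth. Qed.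

Lemma actC s t x : act s (act t x) = act t (act s x).
Proof. by rewrite -!actD addrC. Qed.

Lemma open_setX_cimg (i : cidx M) : open [set z : 'rV[R]_n * 'rV[R]_m | cimg i z.2].
Proof.
apply: open_comp; last exact: open_cimg.
by move=> z _; exact: cvg_snd.
Qed.

Lemma act_continuous (i : cidx M) : {in [set z : 'rV[R]_n * 'rV[R]_m | cimg i z.2],
  continuous (fun z => act (torus_pi z.1) (cinv i z.2))}.
Proof. by case: act_smooth => _ _ /(_ i)[]. Qed.

Lemma act_continuous_at (i : cidx M) (z : 'rV[R]_n * 'rV[R]_m) : cimg i z.2 ->
  {for z, continuous (fun z => act (torus_pi z.1) (cinv i z.2))}.
Proof. by move=> iz; apply: (@act_continuous i z); exact: mem_set. Qed.

Lemma open_act_dom i j : open (act_dom i j).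
Proof.
apply: (open_preimage (f := fun z => act (torus_pi z.1) (cinv i z.2))).
- exact: open_setX_cimg.
- exact: act_continuous.
- exact: cdom_open.
Qed.

Lemma smooth_act_in i j : smooth_on (act_dom i j) (act_in i j).
Proof. by case: act_smooth => _ _ /(_ i)[_]; exact. Qed.

Lemma act_dom0 i y : cimg i y -> act_dom i i (0, y).
Proof.
by move=> iy; split=> //=; rewrite torus_pi0 act0; exact: cdom_cinv.
Qed.

Lemma smooth_act_inl i j y : cimg i y ->
  smooth_on [set s | act_dom i j (s, y)] (fun s => act_in i j (s, y)).
Proof.
move=> iy; apply: (smooth_on_affine (A := fun s => (s, y))
  (B := fun v => (v, 0)) (E := act_dom i j)) => //; last exact: smooth_act_in.
by move=> x v h; congr pair; rewrite /= scaler0 add0r.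
Qed.

Lemma smooth_act_inr i j s :
  smooth_on [set y | act_dom i j (s, y)] (fun y => act_in i j (s, y)).
Proof.
apply: (smooth_on_affine (A := fun y => (s, y))
  (B := fun v => (0, v)) (E := act_dom i j)) => //; last exact: smooth_act_in.
by move=> x v h; congr pair; rewrite /= scaler0 add0r.
Qed.

(** Seen as a derivative of the jointly smooth [act_in] in a torus direction, the field depends
    smoothly on [y]. *)
Lemma fieldE v i y : field v i y = 'D_(v, 0) (act_in i i) (0, y).
Proof.
rewrite /fundamental_field -(derive_affine (A := fun s => (s, y)) _ (v := v))// => h.
by congr pair; rewrite /= scaler0 add0r.
Qed.

Lemma smooth_field v i : smooth_on (cimg i) (field v i).
Proof.
rewrite (_ : field v i = 'D_(v, 0) (act_in i i) \o (fun y => (0, y))); last first.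
  by apply/funext => y; exact: fieldE.
apply: (smooth_on_affine (B := fun v => (0, v)) (E := act_dom i i)) => //.
- by move=> x w h; congr pair; rewrite /= scaler0 add0r.
- by move=> y iy; exact: act_dom0.
- exact/smooth_on_derive/smooth_act_in.
Qed.

Lemma continuous_act_orbit x : continuous (fun s => act (torus_pi s) x).
Proof.
move=> s; have [i ix] := cdom_cover x.
rewrite -(cdomK ix).
apply: (@continuous_comp _ _ _ (fun s => (s, cmap i x))
  (fun z => act (torus_pi z.1) (cinv i z.2))).
  exact: differentiable_continuous.
by apply: act_continuous_at; exact: cimg_cmap.
Qed.

Lemma continuous_act t : continuous (act t).
Proof.
move=> x; have [i ix] := cdom_cover x; have [s <-] := torus_pi_surj t.
have : {for x, continuous (fun x => act (torus_pi s) (cinv i (cmap i x)))}.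
  apply: (@continuous_comp _ _ _ (fun x => (s, cmap i x))
    (fun z => act (torus_pi z.1) (cinv i z.2))).
    exact: (@cvg_pair _ _ _ (nbhs x) (nbhs s) (nbhs (cmap i x)) _ _ _
      (fun=> s) (cmap i) (cvg_cst s) (continuous_cmap ix)).
  by apply: act_continuous_at; exact: cimg_cmap.
rewrite /prop_for /continuous_at cdomK//; apply: cvg_trans.
by apply: near_eq_cvg; apply: filterS (near_cdom ix) => z iz; rewrite cdomK.
Qed.

Definition orbit_in (j : cidx M) (x : M) (s : 'rV[R]_n) : 'rV[R]_m :=
  cmap j (act (torus_pi s) x).

Lemma open_orbit_in j x : open [set s | cdom j (act (torus_pi s) x)].
Proof.
rewrite (_ : mkset _ = (fun s => act (torus_pi s) x) @^-1` cdom j)//.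
by apply: open_comp => [s _|]; [exact: continuous_act_orbit|exact: cdom_open].
Qed.

Lemma smooth_orbit_in j x :
  smooth_on [set s | cdom j (act (torus_pi s) x)] (orbit_in j x).
Proof.
have [i ix] := cdom_cover x.
have <- : [set s | act_dom i j (s, cmap i x)] = [set s | cdom j (act (torus_pi s) x)].
  apply/seteqP; split=> s; rewrite /act_dom/= cdomK//; first by case.
  by split=> //; exact: cimg_cmap.
have <- : (fun s => act_in i j (s, cmap i x)) = orbit_in j x.
  by apply/funext => s; rewrite /act_in/= cdomK.
exact: (smooth_act_inl _ (cimg_cmap ix)).
Qed.

(** The group law moves the parameter [s] to 0 and the base point to [act (torus_pi s) x]. *)
Lemma derive_orbit_in v j x s : cdom j (act (torus_pi s) x) ->
  'D_v (orbit_in j x) s = field v j (orbit_in j x s).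
Proof.
move=> js; rewrite /fundamental_field /orbit_in cdomK//.
rewrite (_ : (fun s' => cmap j (act (torus_pi s') x)) =
    (fun s' => cmap j (act (torus_pi s') (act (torus_pi s) x))) \o (fun t => t - s)).
  have Aaff (h : R) : h *: v + s - s = h *: v + (s - s) by rewrite addrA.
  by rewrite (derive_affine (A := fun t => t - s) _ Aaff)/= subrr.
by apply/funext => t /=; rewrite -actD -torus_piD subrK.
Qed.

Lemma field_act v i j t y : cimg i y -> cdom j (act t (cinv i y)) ->
  'D_(field v i y) (cmap j \o act t \o cinv i) y =
  field v j (cmap j (act t (cinv i y))).
Proof.
have [s <-] := torus_pi_surj t => iy jy.
pose x := cinv i y; have ix : cdom i x by exact: cdom_cinv.
have x0 : act (torus_pi 0) x = x by rewrite torus_pi0 act0.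
have dF : differentiable (fun y => act_in i j (s, y)) y.
  exact: (smooth_on_differentiable (smooth_act_inr _ _ _)).
have dx : differentiable (orbit_in i x) 0.
  by apply: (smooth_on_differentiable (smooth_orbit_in _ _)); rewrite /= x0.
have y0 : orbit_in i x 0 = y by rewrite /orbit_in x0 cimgK.
have := @derive_chain _ _ _ _ (orbit_in i x) (fun y => act_in i j (s, y)) 0 v dx.
rewrite y0 (derive_orbit_in v (j := i) (x := x) (s := 0)) ?x0// y0 => <-//.
have jx : cdom j (act (torus_pi 0) (act (torus_pi s) x)) by rewrite torus_pi0 act0.
have -> : cmap j (act (torus_pi s) x) = orbit_in j (act (torus_pi s) x) 0.
  by rewrite /orbit_in torus_pi0 act0.
rewrite -derive_orbit_in//; apply: near_eq_derive.
have : \forall u \near (0 : 'rV[R]_n), cdom i (act (torus_pi u) x).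
  apply: open_nbhs_nbhs; split; first exact: open_orbit_in.
  by rewrite /= x0.
by apply: filterS => u iu; rewrite /= /act_in /= /orbit_in cdomK// actC.
Qed.

Definition field_mx (i : cidx M) (y : 'rV[R]_m) : 'M[R]_(n, m) :=
  \matrix_(a, b) field (basis_vec a) i y 0 b.

Lemma row_field_mx i y a : row a (field_mx i y) = field (basis_vec a) i y.
Proof. by apply/rowP => b; rewrite !mxE. Qed.

Lemma field_mxE v i y : cimg i y -> field v i y = v *m field_mx i y.
Proof.
move=> iy; have dx : differentiable (fun s => act_in i i (s, y)) 0.
  exact: (smooth_on_differentiable (smooth_act_inl _ _) (act_dom0 _)).
rewrite mulmx_sum_row [LHS](derive_basis _ dx).
by apply: eq_bigr => a _; rewrite row_field_mx.
Qed.

End Action.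

(** * Existence of a regular point *)

Section Stabilizers.
Context {R : realType} {n m : nat} {M : manifold R m}.
Variable act : torus R n -> M -> M.
Hypothesis act_smooth : smooth_action act.

Local Notation field := (fundamental_field act).
Local Notation act0 := (act0 act_smooth).
Local Notation actD := (actD act_smooth).

Lemma act_fixMn t x k : act t x = x -> act (t *+ k) x = x.
Proof.
by move=> tx; elim: k => [|k IH]; rewrite ?mulr0n ?act0// mulrS actD IH.
Qed.

Lemma act_fixN t x : act t x = x -> act (- t) x = x.
Proof. by move=> tx; rewrite -[in LHS]tx -actD addNr act0. Qed.

(** By [field_act] the velocity of the orbit curve at each time is the push-forward of the field at
    the starting point, hence zero. So the curve is constant while it stays in the chart, and any
    [c] is reached by finitely many small steps. *)
Lemma fixed_line v (i : cidx M) y : cimg i y -> field v i y = 0 ->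
  forall c : R, act (torus_pi (c *: v)) (cinv i y) = cinv i y.
Proof.
move=> iy vy0; set x := cinv i y.
have ix : cdom i x by exact: cdom_cinv.
pose f := orbit_in act i x.
have x0 : act (torus_pi 0) x = x by rewrite torus_pi0 act0.
have : \forall c \near (0 : R), cdom i (act (torus_pi (c *: v)) x).
  apply: open_nbhs_nbhs; split; last by rewrite /= scale0r x0.
  apply: (@open_comp _ _ (fun c : R => c *: v)
    [set s | cdom i (act (torus_pi s) x)]); last exact: open_orbit_in.
  by move=> c _; exact: scalel_continuous.
move=> /(nbhs_ballP 0 _).1 [e /= e0 eB].
have small (c : R) : `|c| < e -> act (torus_pi (c *: v)) x = x.
  move=> ce; have iB (t : R) : 0 <= t <= 1 ->
      cdom i (act (torus_pi (0 + t *: (c *: v))) x).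
    move=> /andP[t0 t1]; rewrite add0r scalerA; apply: eB.
    rewrite -ball_normE/= sub0r normrN normrM ger0_norm//.
    by rewrite (le_lt_trans _ ce)// ler_piMl.
  suff fc : f (c *: v) = f 0.
    have := congr1 (cinv i) fc; rewrite /f /orbit_in x0 cdomK ?cdomK//.
    by have := iB 1; rewrite add0r scale1r; apply; rewrite ler01 lexx.
  apply/rowP => j; apply/eqP; rewrite -subr_eq0; apply/eqP.
  have df (t : R) : 0 <= t <= 1 -> differentiable f (0 + t *: (c *: v)).
    by move=> /iB; exact: (smooth_on_differentiable (smooth_orbit_in act_smooth i x)).
  have dfj (t : R) : 0 <= t <= 1 ->
      differentiable (fun s => f s 0 j) (0 + t *: (c *: v)).
    move=> /df ?; apply: (@differentiable_comp _ _ _ _ f (fun N : 'rV[R]_m => N 0 j)) => //.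
    exact: differentiable_coord.
  have [t t01] := @mvt_line R _ (fun s => f s 0 j) 0 (c *: v) dfj.
  have {}t01 : 0 <= t <= 1 by case/andP: t01 => ? ?; rewrite !ltW.
  rewrite add0r => ->.
  have hf := is_derive_diff (c *: v) (df _ t01).
  rewrite (@derive_val _ _ _ _ _ _ _ (is_derive_entry 0 j hf)).
  rewrite (derive_orbit_in act_smooth); last exact: iB.
  have := field_act act_smooth (c *: v) iy (iB t t01); rewrite /orbit_in => <-.
  rewrite field_mxE// -scalemxAl -field_mxE// vy0 scaler0 derive0.
  by rewrite mxE.
move=> c; have [k ck] : exists k : nat, `|c| / k.+1%:R < e.
  exists (Num.truncn (`|c| / e)).
  by rewrite ltr_pdivrMr// mulrC -ltr_pdivrMr//; exact: truncnS_gt.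
have -> : c *: v = ((c / k.+1%:R) *: v) *+ k.+1.
  by rewrite -scaler_nat scalerA mulrC divfK// pnatr_eq0.
rewrite torus_piMn; apply: act_fixMn; apply: small.
by rewrite normrM normfV normr_nat.
Qed.

(** [P] splits [e] into [e *m P] and a kernel part, and the kernel part fixes the point by
    [fixed_line]. So [e *m P] fixes it too, and the injectivity of [G] near 0 gives [e *m P = 0]. *)
Lemma near_fixed_ker (i : cidx M) y : cimg i y ->
  exists2 r : R, 0 < r & forall e, `|e| < r ->
    act (torus_pi e) (cinv i y) = cinv i y -> field e i y = 0.
Proof.
move=> iy; set x := cinv i y; have ix : cdom i x by exact: cdom_cinv.
pose f := orbit_in act i x.
have x0 : act (torus_pi 0) x = x by rewrite torus_pi0 act0.
have f0 : f 0 = y by rewrite /f /orbit_in x0 cimgK.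
(* [pinvmx A] is a generalized inverse: [P] is a projection and [1%:M - P] maps onto the left kernel
   of [A]. *)
set A := field_mx act i y; pose P := A *m pinvmx A.
have AP : P *m A = A by rewrite mulmxKpV.
(* The orbit map, completed along the kernel of its derivative [A] so that its
   derivative at 0 is the identity. *)
pose G (s : 'rV[R]_n) : 'rV[R]_n := f s *m pinvmx A + s *m (1%:M - P).
pose G' (u s : 'rV[R]_n) : 'rV[R]_n := ('D_u f s) *m pinvmx A + u *m (1%:M - P).
pose D := [set s | cdom i (act (torus_pi s) x)].
have sf : smooth_on D f by exact: smooth_orbit_in.
have D0 : D 0 by rewrite /D /= x0.
have Dn : \forall s \near (0 : 'rV[R]_n), D s.
  by apply: open_nbhs_nbhs; split=> //; exact: open_orbit_in.
have [r0 r00 inj] : exists2 r : R, 0 < r &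
    forall x y, ball 0 r x -> ball 0 r y -> G x = G y -> x = y.
  apply: (local_inj (F' := G')).
  - apply: filterS Dn => s Ds; have dfs := smooth_on_differentiable sf Ds.
    have d1 : differentiable (fun s => f s *m pinvmx A) s.
      apply: (@differentiable_comp _ _ _ _ f (fun u => u *m pinvmx A)) => //.
      exact: differentiable_mulmxr.
    split=> [|u]; first by apply: differentiableD => //; exact: differentiable_mulmxr.
    have h1 := is_derive_mulmxr (pinvmx A) (is_derive_diff u dfs).
    have h2 := is_derive_mulmxr (1%:M - P) (is_derive_id s u).
    exact: (@derive_val _ _ _ _ _ _ _ (is_deriveD h1 h2)).
  - move=> u; apply: (@continuousD _ _ _ (fun s => 'D_u f s *m pinvmx A));
      last exact: cst_continuous.
    apply: (@continuous_comp _ _ _ ('D_u f) (fun w => w *m pinvmx A)).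
      exact: (smooth_on_continuous (smooth_on_derive u sf)).
    exact/differentiable_continuous/differentiable_mulmxr.
  - move=> u; rewrite /G' derive_orbit_in//.
    rewrite -/f f0 field_mxE// -/A -mulmxA -/P -mulmxDr.
    by rewrite addrC subrK mulmx1.
have : \forall e \near (0 : 'rV[R]_n), ball 0 r0 (e *m P).
  have := @differentiable_continuous _ _ _ _ _ (@differentiable_mulmxr _ _ _ P 0).
  by rewrite /prop_for /continuous_at mul0mx => /(_ (ball 0 r0)); apply; exact: nbhsx_ballx.
move=> /(nbhs_ballP 0 _).1 [r /= r_gt0 rB]; exists r => // e er ex.
have ker0 : field (e *m (1%:M - P)) i y = 0.
  by rewrite field_mxE// -mulmxA mulmxBl mul1mx AP subrr mulmx0.
have eP : e *m P = e - e *m (1%:M - P) by rewrite mulmxBr mulmx1 opprB addrC subrK.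
have cx : act (torus_pi (e *m P)) x = x.
  rewrite eP torus_piD actD torus_piN act_fixN//.
  by have := fixed_line iy ker0 1; rewrite scale1r.
suff eP0 : e *m P = 0 by rewrite field_mxE// -/A -AP mulmxA eP0 mul0mx.
apply: inj.
- by apply: rB; rewrite -ball_normE/= sub0r normrN.
- exact: ballxx.
have fP : f (e *m P) = f 0 by rewrite /f /orbit_in cx x0.
rewrite /G fP mul0mx addr0 -mulmxA mulmxBr mulmx1.
by rewrite [P *m P]mulmxA AP subrr mulmx0 addr0.
Qed.

End Stabilizers.

Lemma closed_fix (T : topologicalType) (f : T -> T) :
  hausdorff_space T -> continuous f -> closed [set x | f x = x].
Proof.
move=> hT cf x clx; apply: hT => A B fxA xB.
have fA : nbhs x (f @^-1` A) by exact: cf.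
have [y [/= fy [Ay By]]] := clx _ (filterI fA xB).
by exists y; split=> //; rewrite -fy.
Qed.

(* Baire's theorem needs matrices to be a complete normed module; the library
   only has the two structures separately. *)
HB.instance Definition _ (R : realType) m n := Complete.on 'M[R]_(m, n).

(** * Fixed sets of torsion elements and the Baire argument *)

Section FixedPoints.
Context {R : realType} {n m : nat} {M : manifold R m}.
Variable act : torus R n -> M -> M.
Hypothesis act_smooth : smooth_action act.
Hypothesis M_connected : connected [set: M].

Local Notation field := (fundamental_field act).
Local Notation act0 := (act0 act_smooth).
Local Notation actD := (actD act_smooth).

Lemma closed_fixed t : closed [set x | act t x = x].
Proof. by apply: closed_fix; [exact: man_hausdorff|exact: continuous_act]. Qed.

(** On the interior of the fixed set the chart expression is the identity; continuity of its
    derivative extends this to the closure. *)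
Lemma derive_closure_fixed s (i : cidx M) x u : cdom i x ->
  closure [set x | act (torus_pi s) x = x]^° x ->
  'D_u (fun y => act_in act i i (s, y)) (cmap i x) = u.
Proof.
move=> ix clx; set F := fun y => _; set y := cmap i x.
have sx : act (torus_pi s) x = x.
  apply: closed_fixed; apply: closureS clx; exact: interior_subset.
have Dy : act_dom act i i (s, y).
  by split=> /=; [exact: cimg_cmap|rewrite cdomK// sx].
have cF : {for y, continuous ('D_u F)}.
  exact: (smooth_on_continuous (smooth_on_derive u (smooth_act_inr act_smooth i i s)) Dy).
apply/eqP/negPn/negP => neq.
pose N := [set z | 'D_u F z != u].
have yN : nbhs y N.
  have e0 : 0 < `|'D_u F y - u| by rewrite normr_gt0 subr_eq0.
  have /cvgrPdist_lt/(_ _ e0) := cF.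
  by apply: filterS => z; apply: contraTneq => ->; rewrite ltxx.
have xN : nbhs x (cmap i @^-1` N) by exact: (continuous_cmap ix yN).
have [x' [Ax' [ix' nx']]] := clx _ (filterI (near_cdom ix) xN).
apply: (negP nx'); apply/eqP; rewrite -[RHS](derive_id (cmap i x')); apply: near_eq_derive.
have iy' := cimg_cmap ix'.
have nA : \forall z \near cmap i x', [set x | act (torus_pi s) x = x] (cinv i z).
  by apply: (continuous_cinv iy'); rewrite cdomK.
by apply: filterS (filterI nA (near_cimg iy')) => z [/= zs iz]; rewrite /F /act_in /= zs cimgK.
Qed.

(** [F k] is the [k]-th power of the action of [s] read in a chart, and [h] is the average over a
    period. By [derive_closure_fixed], [h] has the identity as derivative at [y] and so is injective
    nearby; as [h (F 1 z) = h z], it follows that [F 1 z = z]. *)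
Lemma fixed_near_closure s q (i : cidx M) x : torus_pi (s *+ q.+1) = 0 -> cdom i x ->
  closure [set x | act (torus_pi s) x = x]^° x ->
  [set x | act (torus_pi s) x = x]^° x.
Proof.
move=> sq0 ix clx; set y := cmap i x; have iy : cimg i y by exact: cimg_cmap.
pose F k y := act_in act i i (s *+ k, y).
pose D k := [set y | act_dom act i i (s *+ k, y)].
have sx : act (torus_pi s) x = x.
  apply: closed_fixed; apply: closureS clx; exact: interior_subset.
have clk k : closure [set x | act (torus_pi (s *+ k)) x = x]^° x.
  apply: closureS clx; apply: interiorS => z /= sz; rewrite torus_piMn.
  exact: (act_fixMn act_smooth).
have sf k : smooth_on (D k) (F k) by exact: smooth_act_inr.
have Dy k : D k y.
  by split=> //=; rewrite cdomK// torus_piMn (act_fixMn act_smooth).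
have Dn k : \forall z \near y, D k z.
  apply: open_nbhs_nbhs; split=> //.
  apply: (@open_comp _ _ (fun z => (s *+ k, z)) (act_dom act i i)); last exact: open_act_dom.
  by move=> z _; exact: differentiable_continuous.
have derF k u : 'D_u (F k) y = u by exact: derive_closure_fixed.
pose c : R := q.+1%:R^-1.
pose h := c *: \sum_(k < q.+1) F k.
pose h' u := c *: \sum_(k < q.+1) 'D_u (F k).
have [r r0 inj] : exists2 r : R, 0 < r &
    forall z w, ball y r z -> ball y r w -> h z = h w -> z = w.
  apply: (local_inj (F' := h')).
  - have Dall : \forall z \near y, forall k : 'I_q.+1, D k z.
      by apply: (@filter_forall _ _ _ (nbhs y)) => k; exact: Dn.
    apply: filterS Dall => z Dz.
    have dF (k : 'I_q.+1) : differentiable (F k) z.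
      exact: (smooth_on_differentiable (sf k) (Dz k)).
    have dsum : differentiable (\sum_(k < q.+1) F k) z by exact: differentiable_sum.
    split=> [|u]; first exact: differentiableZ.
    rewrite deriveZ; last exact: diff_derivable.
    rewrite derive_sum; last by move=> k; exact: diff_derivable.
    by rewrite /h' fctE; congr (_ *: _); rewrite fct_sumE.
  - move=> u; apply: differentiable_continuous; apply: differentiableZ.
    apply: differentiable_sum => k.
    exact: (smooth_on_differentiable (smooth_on_derive u (sf k)) (Dy k)).
  - move=> u; rewrite /h' fctE fct_sumE (eq_bigr (fun=> u)) => [|k _]; last exact: derF.
    by rewrite sumr_const card_ord -scaler_nat scalerA mulVf ?scale1r// pnatr_eq0.
have F0 z : cimg i z -> F 0%N z = z.
  by move=> iz; rewrite /F /act_in /= mulr0n torus_pi0 act0 cimgK.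
have F1y : F 1%N y = y by rewrite /F /act_in /= mulr1n cdomK// sx.
have n1 : \forall z \near y, ball y r (F 1%N z).
  have := smooth_on_continuous (sf 1%N) (Dy 1%N).
  by rewrite /prop_for /continuous_at F1y; apply; exact: nbhsx_ballx.
have nB : \forall z \near y, ball y r z by exact: nbhsx_ballx.
have near_fix : \forall z \near y, act (torus_pi s) (cinv i z) = cinv i z.
  apply: filterS (filterI (filterI n1 nB) (Dn 1%N)) => z [[z1 zB] [/= iz]].
  rewrite mulr1n => isz.
  have F1z : F 1%N z = z.
    apply: inj => //; rewrite /h !fctE !fct_sumE; congr (_ *: _).
    rewrite (eq_bigr (fun k : 'I_q.+1 => F k.+1 z)) => [|k _]; last first.
      by rewrite {1}/F /act_in /= /F /act_in /= mulr1n cdomK// -actD -torus_piD -mulrSr.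
    (* The shifted sum trades the term of index 0 for that of index [q.+1]; both send [z] to itself,
       because [torus_pi (s *+ q.+1) = 0]. *)
    rewrite [LHS]big_ord_recr [RHS]big_ord_recl/= addrC; congr (_ + _).
    by rewrite F0// /F /act_in /= sq0 act0 cimgK.
  have := congr1 (cinv i) F1z; rewrite /F /act_in /= mulr1n cdomK//.
have : \forall x' \near x, act (torus_pi s) (cinv i (cmap i x')) = cinv i (cmap i x').
  exact: (continuous_cmap ix near_fix).
by apply: filterS2 (near_cdom ix) => x' ix' /=; rewrite cdomK.
Qed.

(** The interior of the fixed set is open, nonempty and, by [fixed_near_closure], closed. *)
Lemma fixed_open_all t q : t *+ q.+1 = 0 -> [set x | act t x = x]^° !=set0 ->
  forall x, act t x = x.
Proof.
have [s <-] := torus_pi_surj t; rewrite -torus_piMn => sq0 A0 x.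
suff AT : [set x | act (torus_pi s) x = x]^° = setT.
  by have : [set x | act (torus_pi s) x = x]^° x; [rewrite AT|move/interior_subset].
apply: M_connected => //.
- exists [set x | act (torus_pi s) x = x]^°; rewrite ?setTI//; exact: open_interior.
- exists [set x | act (torus_pi s) x = x]^°; rewrite ?setTI// => z clz.
  by have [i iz] := cdom_cover z; exact: (fixed_near_closure sq0 iz).
Qed.

Hypothesis M_nonempty : [set: M] !=set0.
Hypothesis act_effective : effective act.

(** Its successor, the denominator in [torsion_vec], exceeds every [|w j|], so the entries of
    [torsion_vec w] lie strictly between -1 and 1 and a nonzero [w] gives a nonintegral vector. The
    index type is countable, as Baire's theorem requires. *)
Definition torsion_order (w : 'rV[int]_n) : nat := \sum_j absz (w ord0 j).

Definition torsion_vec (w : 'rV[int]_n) : 'rV[R]_n :=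
  (torsion_order w).+1%:R^-1 *: map_mx intr w.

Lemma torsion_vecMn w : torus_pi (torsion_vec w) *+ (torsion_order w).+1 = 0.
Proof.
rewrite -torus_piMn -scaler_nat scalerA mulfV ?pnatr_eq0// scale1r.
apply/eqP; rewrite torus_pi_eq0; apply/mxOverP => i j.
by rewrite mxE rpred_int.
Qed.

Lemma torsion_vec_neq0 w : w != 0 -> torus_pi (torsion_vec w) != 0.
Proof.
move=> w0; rewrite torus_pi_eq0; apply/negP => /mxOverP wZ.
have [j wj] : exists j, w 0 j != 0.
  apply/existsP; apply: contraNT w0; rewrite negb_exists => /forallP w0.
  by apply/eqP/rowP => j; rewrite mxE; apply/eqP/negPn; exact: w0.
have := wZ 0 j; rewrite !mxE => /norm_intr_ge1.
rewrite mulf_neq0 ?invr_eq0 ?pnatr_eq0 ?intr_eq0// => /(_ isT).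
rewrite normrM normfV normr_nat mulrC ler_pdivlMr// mul1r -intr_norm.
rewrite -abszE -pmulrn ler_nat ltnNge => /negP; apply.
by rewrite /torsion_order (bigD1 j)//= leq_addr.
Qed.

(** Dirichlet's theorem makes [t *: v - z] small with [z] integral. It fixes the point, because
    [t *: v] does and [z] acts trivially, so its field vanishes by [near_fixed_ker]. Then so does
    the field of [z], and the line through [z] contains a torsion vector. *)
Lemma exists_torsion_fixing (i : cidx M) y v : cimg i y -> v != 0 ->
  field v i y = 0 ->
  exists2 w : 'rV[int]_n, w != 0 &
    act (torus_pi (torsion_vec w)) (cinv i y) = cinv i y.
Proof.
move=> iy v0 vy0; have [r r0 rker] := near_fixed_ker act_smooth iy.
have [t [z [zZ z0 ze]]] := dirichlet v0 r0.
have piz : torus_pi z = 0 by apply/eqP; rewrite torus_pi_eq0.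
have : field (t *: v - z) i y = 0.
  apply: rker => //; rewrite torus_piD torus_piN piz oppr0 addr0.
  exact: fixed_line.
rewrite field_mxE// mulmxBl -scalemxAl -!field_mxE// vy0 scaler0 sub0r.
move/eqP; rewrite oppr_eq0 => /eqP zy0.
pose w : 'rV[int]_n := map_mx Num.floor z.
have zw : z = map_mx intr w.
  by apply/rowP => j; rewrite !mxE floorK//; exact: (mxOverP zZ).
exists w; first by apply: contraNneq z0 => w0; rewrite zw w0 map_mx0.
by rewrite /torsion_vec -zw; exact: fixed_line.
Qed.

Lemma exists_free : exists (i : cidx M) y, cimg i y /\
  forall v, field v i y = 0 -> v = 0.
Proof.
apply: contrapT => nofree.
have fixed x : exists2 w : 'rV[int]_n, w != 0 & act (torus_pi (torsion_vec w)) x = x.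
  have [i ix] := cdom_cover x; rewrite -(cdomK ix).
  have iy := cimg_cmap ix.
  apply: contrapT => nw; apply: nofree; exists i, (cmap i x); split=> // v vy0.
  by apply/eqP/negPn/negP => v0; apply: nw; exact: exists_torsion_fixing vy0.
have [x0 _] := M_nonempty; have [i ix0] := cdom_cover x0.
have /(nbhs_ballP (cmap i x0) _).1 [r /= r0 rB] := near_cimg (cimg_cmap ix0).
pose C := closed_ball (cmap i x0) (r / 2).
have CU : C `<=` cimg i.
  move=> z; rewrite /C closed_ballE ?divr_gt0//= => zr; apply: rB.
  by rewrite -ball_normE/= (le_lt_trans zr)// ltr_pdivrMr// ltr_pMr// ltr1n.
pose P (w : 'rV[int]_n) z := act (torus_pi (torsion_vec w)) (cinv i z) = cinv i z.
(* Within [C] this is the set of points moved by the torsion element of code [k]. The complement of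
   [C] extends it to the whole space, and [setT] serves the indices that code no nonzero vector. *)
pose F k : set 'rV[R]_m := if unpickle k is Some w then
  if w == 0 then setT else ~` C `|` (cimg i `&` [set z | ~ P w z]) else setT.
have oF k : open (F k).
  rewrite /F; case: unpickle => [w|]; last exact: openT.
  case: eqP => _; first exact: openT.
  apply: openU; first by apply: closed_openC; exact: closed_ball_closed.
  rewrite (_ : _ `&` _ = cimg i `&` cinv i @^-1`
    ~` [set x | act (torus_pi (torsion_vec w)) x = x])//.
  apply: open_preimage; first exact: open_cimg.
    by move=> z /set_mem; exact: continuous_cinv.
  by apply: closed_openC; exact: closed_fixed.
have [k nd] : exists k, ~ dense (F k).
  apply: contrapT => alld.
  have odF k : open (F k) /\ dense (F k).
    by split=> //; apply: contrapT => nk; apply: alld; exists k.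
  (* A point of the ball common to all [F k] would be moved by every one of these torsion elements,
     against [fixed]. *)
  have dF := @Baire R 'rV[R]_m F odF.
  have [] := dF (ball (cmap i x0) (r / 2)).
  - by exists (cmap i x0); apply: ballxx; rewrite divr_gt0.
  - exact: ball_open.
  - move=> z [zr Fz]; have [w w0 zw] := fixed (cinv i z).
    have := Fz (pickle w) I; rewrite /F pickleK (negbTE w0) => -[|[_]]; last by apply.
    by apply; exact: subset_closed_ball.
(* A set that is not dense misses a nonempty open set; here that set lies in [C] and consists of
   fixed points. *)
have [N [N0 oN NF]] : exists N, [/\ N !=set0, open N & forall z, N z -> ~ F k z].
  apply: contrapT => nO; apply: nd => N N0 oN; apply: contrapT => NF.
  by apply: nO; exists N; split=> // z Nz Fz; apply: NF; exists z.
have [z Nz] := N0; move: NF; rewrite /F; case: unpickle => [w|/(_ z Nz)]; last exact.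
case: (eqVneq w 0) => [_ /(_ z Nz)|w0 NF]; first exact.
have NP z' : N z' -> cimg i z' /\ P w z'.
  move=> /NF nF; have Cz : C z' by apply: contrapT => nC; apply: nF; left.
  split; first exact: CU.
  by apply: contrapT => nP; apply: nF; right; split => //; exact: CU.
have [iz _] := NP z Nz.
apply/negP: (torsion_vec_neq0 w0); rewrite negbK; apply/eqP.
apply: act_effective; apply: (fixed_open_all (torsion_vecMn w)).
exists (cinv i z); have zN : \forall z' \near z, N z' by exact: open_nbhs_nbhs.
have ix := cdom_cinv iz.
have xN : \forall x \near cinv i z, N (cmap i x).
  by apply: (continuous_cmap ix); rewrite cimgK.
by apply: filterS (filterI (near_cdom ix) xN) => x [ix' /= /NP[_]]; rewrite /P cdomK.
Qed.

End FixedPoints.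

(** * Mean curvature of orbits *)

Section BilinearAlgebra.
Context {R : realType} {m : nat}.
Implicit Types (B : 'M[R]_m) (u v w : 'rV[R]_m).

Lemma bilDl B u v w : bil B (u + v) w = bil B u w + bil B v w.
Proof. by rewrite /bil !mulmxDl mxE. Qed.

Lemma bilZl B c u w : bil B (c *: u) w = c * bil B u w.
Proof. by rewrite /bil -!scalemxAl mxE. Qed.

Lemma bil_suml I (r : seq I) (P : pred I) B (f : I -> 'rV[R]_m) w :
  bil B (\sum_(i <- r | P i) f i) w = \sum_(i <- r | P i) bil B (f i) w.
Proof. by rewrite /bil !mulmx_suml summxE. Qed.

Lemma bilC B u v : B^T = B -> bil B u v = bil B v u.
Proof.
move=> BT; rewrite /bil.
have -> : u *m B *m v^T = (v *m B *m u^T)^T by rewrite !trmx_mul trmxK BT mulmxA.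
by rewrite mxE.
Qed.

Lemma bil_linear_comb k (c : 'I_k -> R) (H : 'I_k -> 'M[R]_m) u v :
  bil (\sum_d c d *: H d) u v = \sum_d c d * bil (H d) u v.
Proof.
rewrite /bil mulmx_sumr mulmx_suml summxE; apply: eq_bigr => d _.
by rewrite -scalemxAr -scalemxAl mxE.
Qed.

(* [H d] stands for the derivative of the metric [B] in the [d]-th direction,
   and [Hu], [Hv], [Hw] for its derivatives along [u], [v], [w]. *)
Lemma bil_christoffel (B : 'M[R]_m) (H : 'I_m -> 'M[R]_m) (Hu Hv Hw : 'M[R]_m) u v w :
  B^T = B -> B \in unitmx -> Hu = \sum_d u 0 d *: H d ->
  Hv = \sum_d v 0 d *: H d -> Hw = \sum_d w 0 d *: H d ->
  bil B (\row_c \sum_d \sum_e (2^-1 * \sum_f invmx B c f *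
    (H d e f + H e d f - H f d e)) * u 0 d * v 0 e) w =
  2^-1 * (bil Hu v w + bil Hv u w - bil Hw u v).
Proof.
move=> BT Bu -> -> ->.
(* [V] collects the Christoffel symbols with lowered index, up to the factor 1/2; pairing with [B]
   cancels [invmx B]. *)
pose V : 'rV[R]_m := \row_f \sum_d \sum_e (H d e f + H e d f - H f d e) * u 0 d * v 0 e.
have -> : (\row_c \sum_d \sum_e (2^-1 * \sum_f invmx B c f *
    (H d e f + H e d f - H f d e)) * u 0 d * v 0 e) = 2^-1 *: (V *m (invmx B)^T).
  apply/rowP => c; rewrite !mxE.
  under [in RHS]eq_bigr => f _.
    rewrite !mxE mulr_suml.
    under eq_bigr => d _ do rewrite mulr_suml.
    over.
  rewrite /= [in RHS]exchange_big [RHS]mulr_sumr; apply: eq_bigr => d _ /=.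
  rewrite [in RHS]exchange_big [RHS]mulr_sumr; apply: eq_bigr => e _ /=.
  rewrite -!mulrA mulr_suml; congr (_ * _); apply: eq_bigr => f _.
  by rewrite -!mulrA mulrC !mulrA.
rewrite bilZl; congr (_ * _); rewrite {1}/bil -(mulmxA V).
have -> : (invmx B)^T *m B = 1%:M by rewrite -{2}BT -trmx_mul mulmxV// trmx1.
rewrite mulmx1 mxE.
rewrite !bil_linear_comb.
under eq_bigr => f _ do rewrite !mxE mulr_suml.
rewrite /= exchange_big /=.
under [in RHS]eq_bigr => d _ do rewrite bilE mulr_sumr.
under [X in _ + X - _]eq_bigr => e _ do rewrite bilE mulr_sumr.
under [X in _ + _ - X]eq_bigr => f _ do rewrite bilE mulr_sumr.
rewrite /= [X in _ + X - _]exchange_big/= -big_split/=.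
rewrite [X in _ - X]exchange_big/= -sumrB; apply: eq_bigr => d _.
rewrite -big_split/=.
under eq_bigr => f _ do rewrite mulr_suml.
rewrite exchange_big/=.
under [in RHS]eq_bigr => e _ do rewrite !mulr_sumr -big_split/=.
under [X in _ - X]eq_bigr => e _ do rewrite mulr_sumr.
rewrite [X in _ - X]exchange_big/= -sumrB; apply: eq_bigr => e _.
rewrite -sumrB; apply: eq_bigr => f _.
by ring.
Qed.

(* [S] will be the inverse of the Gram matrix, and [E], [L] and [K] the terms in
   [bil_cov_orbit] below. *)
Lemma trace_contraction k (S E L : 'M[R]_k) (K : 'I_k -> 'I_k -> R) :
  S^T = S -> E^T = E -> \tr (S *m (E + L + L^T)) = 0 ->
  \sum_a \sum_b S a b * (2^-1 * (K a b - K b a - E a b) - L a b) = 0.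
Proof.
move=> ST ET tr0.
have SC a b : S a b = S b a by rewrite -{1}ST mxE.
have EC a b : E a b = E b a by rewrite -{1}ET mxE.
have antiK : \sum_a \sum_b S a b * (K a b - K b a) = 0.
  under eq_bigr => a _ do under eq_bigr => b _ do rewrite mulrBr.
  under eq_bigr => a _ do rewrite sumrB.
  rewrite sumrB [X in _ - X]exchange_big/=; apply/eqP; rewrite subr_eq0; apply/eqP.
  by apply: eq_bigr => a _; apply: eq_bigr => b _; rewrite SC.
have LT : \sum_a \sum_b S a b * L b a = \sum_a \sum_b S a b * L a b.
  by rewrite exchange_big; apply: eq_bigr => a _; apply: eq_bigr => b _; rewrite SC.
have trE : \sum_a \sum_b S a b * E a b + 2 * \sum_a \sum_b S a b * L a b = 0.
  rewrite -[RHS]tr0 /mxtrace mulrDl mul1r addrA -{2}LT -!big_split/=.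
  apply: eq_bigr => a _; rewrite mxE -!big_split/=; apply: eq_bigr => b _.
  by rewrite !mxE (EC b a); ring.
transitivity (2^-1 * (\sum_a \sum_b S a b * (K a b - K b a)) -
  2^-1 * (\sum_a \sum_b S a b * E a b + 2 * \sum_a \sum_b S a b * L a b)).
  rewrite mulrDr mulrA mulVf// mul1r opprD addrA !mulr_sumr -!sumrB.
  apply: eq_bigr => a _; rewrite !mulr_sumr -!sumrB; apply: eq_bigr => b _.
  by rewrite !mulrBr; ring.
by rewrite antiK trE !mulr0 subrr.
Qed.

End BilinearAlgebra.

(** * The Gram matrix of the fundamental fields and the Killing equation *)

Section Gram.
Context {R : realType} {n m : nat} {M : manifold R m}.
Variables (act : torus R n -> M -> M) (g : components M).
Hypothesis act_smooth : smooth_action act.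
Hypothesis g_riemannian : riemannian_metric g.
Hypothesis act_isometric : forall t : torus R n, preserves (act t) g.

Local Notation field := (fundamental_field act).

Lemma riemannian_sym i y : cimg i y -> (g i y)^T = g i y.
Proof. by case: g_riemannian => _ h /h[]. Qed.

Lemma riemannian_pos i y u : cimg i y -> u != 0 -> 0 < bil (g i y) u u.
Proof. by case: g_riemannian => _ h /h[_]; apply. Qed.

Lemma riemannian_eq0 i y u : cimg i y -> bil (g i y) u u = 0 -> u = 0.
Proof.
move=> iy u0; apply/eqP/negPn/negP => /(riemannian_pos iy).
by rewrite u0 ltxx.
Qed.

Lemma riemannian_unit i y : cimg i y -> g i y \in unitmx.
Proof.
move=> iy; rewrite unitmxE unitfE; apply/negP => /det0P[u u0 ug].
by move: u0; rewrite (riemannian_eq0 (u := u) iy) ?eqxx// /bil ug mul0mx mxE.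
Qed.

Lemma smooth_riemannian i : smooth_on (cimg i) (g i).
Proof. by case: g_riemannian => -[]. Qed.

Definition gram (i : cidx M) (y : 'rV[R]_m) : 'M[R]_n :=
  field_mx act i y *m g i y *m (field_mx act i y)^T.

Lemma gramE i y a b :
  gram i y a b = bil (g i y) (field (basis_vec a) i y) (field (basis_vec b) i y).
Proof.
rewrite /bil -!row_field_mx tr_row -row_mul /gram [LHS]mxE [RHS]mxE.
by apply: eq_bigr => k _; congr (_ * _); rewrite [RHS]mxE.
Qed.

Lemma gram_sym i y : cimg i y -> (gram i y)^T = gram i y.
Proof.
by move=> iy; rewrite /gram !trmx_mul trmxK riemannian_sym// mulmxA.
Qed.

(** The quadratic form of the Gram matrix at [v] is the squared length of [field v i y]. *)
Lemma gram_unit i y : cimg i y ->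
  (forall v, field v i y = 0 -> v = 0) <-> gram i y \in unitmx.
Proof.
move=> iy; split=> [inj|Gu v].
  rewrite unitmxE unitfE; apply/negP => /det0P[v v0 vG].
  move: v0; rewrite (inj v) ?eqxx//; apply: (riemannian_eq0 iy).
  rewrite field_mxE// /bil trmx_mul.
  transitivity ((v *m gram i y *m v^T) 0 0); first by rewrite /gram !mulmxA.
  by rewrite vG mul0mx mxE.
rewrite field_mxE// => vA0; rewrite -[v]mulmx1 -(mulmxV Gu) mulmxA /gram.
by rewrite !mulmxA vA0 !mul0mx.
Qed.

Lemma gram_act t i j y : cimg i y -> cdom j (act t (cinv i y)) ->
  gram j (cmap j (act t (cinv i y))) = gram i y.
Proof.
move=> iy jy; apply/matrixP => a b; rewrite [LHS]gramE [RHS]gramE.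
rewrite [RHS](act_isometric iy jy).
by rewrite (field_act act_smooth (basis_vec a) iy jy) (field_act act_smooth (basis_vec b) iy jy).
Qed.

Lemma is_derive_gram i y u : cimg i y ->
  is_derive y u (gram i) (\matrix_(a, b)
    (bil ('D_u (g i) y) (field (basis_vec a) i y) (field (basis_vec b) i y) +
     bil (g i y) ('D_u (field (basis_vec a) i) y) (field (basis_vec b) i y) +
     bil (g i y) (field (basis_vec a) i y) ('D_u (field (basis_vec b) i) y))).
Proof.
move=> iy; apply: is_derive_mx => a b; rewrite mxE.
rewrite (_ : (fun t => _) = fun y => bil (g i y) (field (basis_vec a) i y)
    (field (basis_vec b) i y)); last by apply/funext => z; rewrite gramE.
have hX c := is_derive_diff u (smooth_on_differentiable
  (smooth_field act_smooth (basis_vec c) i) iy).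
have hg := is_derive_diff u (smooth_on_differentiable (smooth_riemannian i) iy).
exact: (is_derive_bil hg (hX a) (hX b)).
Qed.

(** The vanishing Lie derivative of [g] in coordinates: the isometry identity for
    [act (torus_pi s)], tested on constant vectors [u] and [v], is differentiated at [s = 0] along
    [w]. *)
Lemma killing w i y u v : cimg i y ->
  bil ('D_(field w i y) (g i) y) u v +
  bil (g i y) ('D_u (field w i) y) v +
  bil (g i y) u ('D_v (field w i) y) = 0.
Proof.
move=> iy.
pose A := act_in act i i.
pose F (s : 'rV[R]_n) := A (s, y).
pose dA (u : 'rV[R]_m) (s : 'rV[R]_n) := 'D_(0, u) A (s, y).
have D0 : act_dom act i i (0, y) by exact: act_dom0.
have sA : smooth_on (act_dom act i i) A by exact: smooth_act_in.
have oD : open (act_dom act i i) by exact: open_act_dom.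
have nD : \forall s \near (0 : 'rV[R]_n), act_dom act i i (s, y).
  apply: open_nbhs_nbhs; split=> //.
  apply: (@open_comp _ _ (fun s => (s, y)) (act_dom act i i)) => // s _.
  exact: differentiable_continuous.
have F0 : F 0 = y by rewrite /F /A /act_in /= torus_pi0 act0// cimgK.
have dA0 z : dA z 0 = z.
  have <- : 'D_z (fun y => A (0, y)) y = dA z 0.
    by apply: (derive_affine (A := fun y => (0, y))) => h; congr pair; rewrite /= scaler0 add0r.
  rewrite -[RHS](derive_id y); apply: near_eq_derive.
  apply: filterS (near_cimg iy) => y' iy'.
  by rewrite /A /act_in /= torus_pi0 act0// cimgK.
have sF := smooth_act_inl act_smooth i iy.
have dF : differentiable F 0 by exact: (smooth_on_differentiable sF D0).
have dF0 : 'D_w F 0 = field w i y by [].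
have hG : is_derive 0 w (g i \o F) ('D_(field w i y) (g i) y).
  have dg : differentiable (g i) (F 0).
    by rewrite F0; exact: (smooth_on_differentiable (smooth_riemannian i)).
  have := is_derive_comp_lin (is_derive_diff w dF) dF dg.
  by rewrite dF0 F0.
(* Schwarz exchanges the derivative in the torus direction [w] with the one in the space direction
   [z]. *)
have hA z : is_derive 0 w (dA z) ('D_z (field w i) y).
  have -> : 'D_z (field w i) y = 'D_w (dA z) 0.
    have -> : 'D_w (dA z) 0 = 'D_(w, 0) ('D_(0, z) A) (0, y).
      apply: (derive_affine (A := fun s => (s, y))) => h.
      by congr pair; rewrite /= scaler0 add0r.
    rewrite (smooth_on_schwarz _ _ oD sA D0).
    rewrite (_ : field w i = fun y => 'D_(w, 0) A (0, y)); last first.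
      by apply/funext => z'; rewrite fieldE.
    apply: (derive_affine (A := fun y => (0, y))) => h.
    by congr pair; rewrite /= scaler0 add0r.
  apply: is_derive_diff.
  apply: (@differentiable_comp _ _ _ _ (fun s => (s, y)) ('D_(0, z) A)) => //.
  exact: (smooth_on_differentiable (smooth_on_derive _ sA)).
have := @derive_val _ _ _ _ _ _ _ (is_derive_bil hG (hA u) (hA v)).
rewrite !dA0 /= F0 => <-.
rewrite -[RHS](derive_cst (bil (g i y) u v) 0 w); apply: near_eq_derive.
apply: filterS nD => s [/= _ isy]; rewrite (act_isometric iy isy) /cst.
have dE z : 'D_z (cmap i \o act (torus_pi s) \o cinv i) y = dA z s.
  apply: (derive_affine (A := fun y => (s, y))) => h.
  by congr pair; rewrite /= scaler0 add0r.
by rewrite !dE.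
Qed.

End Gram.

(** * The mean curvature of an orbit in terms of its Gram matrix *)

Section MeanCurvature.
Context {R : realType} {n m : nat} {M : manifold R m}.
Variables (act : torus R n -> M -> M) (g : components M).
Hypothesis act_smooth : smooth_action act.
Hypothesis g_riemannian : riemannian_metric g.
Hypothesis act_isometric : forall t : torus R n, preserves (act t) g.

Local Notation field := (fundamental_field act).
Local Notation X a i y := (fundamental_field act (basis_vec a) i y).

Lemma normal_partD k (G : 'rV[R]_m -> 'M[R]_m) (F : 'rV[R]_k -> 'rV[R]_m) t x y :
  normal_part G F t (x + y) = normal_part G F t x + normal_part G F t y.
Proof.
rewrite /normal_part addrACA -opprD; congr (_ - _).
rewrite -big_split; apply: eq_bigr => a _; rewrite -big_split; apply: eq_bigr => b _.
by rewrite /= bilDl mulrDr scalerDl.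
Qed.

Lemma normal_partZ k (G : 'rV[R]_m -> 'M[R]_m) (F : 'rV[R]_k -> 'rV[R]_m) t c x :
  normal_part G F t (c *: x) = c *: normal_part G F t x.
Proof.
rewrite /normal_part scalerBr; congr (_ - _).
rewrite scaler_sumr; apply: eq_bigr => a _; rewrite scaler_sumr; apply: eq_bigr => b _.
by rewrite /= bilZl mulrCA scalerA.
Qed.

Lemma normal_part0 k (G : 'rV[R]_m -> 'M[R]_m) (F : 'rV[R]_k -> 'rV[R]_m) t :
  normal_part G F t 0 = 0.
Proof. by rewrite -[in LHS](scale0r (0 : 'rV[R]_m)) normal_partZ scale0r. Qed.

(** The normal projection is linear, so it can be applied once, after the trace. *)
Lemma mean_curvatureE k (G : 'rV[R]_m -> 'M[R]_m) (F : 'rV[R]_k -> 'rV[R]_m) t :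
  mean_curvature G F t = normal_part G F t (\sum_(a < k) \sum_(b < k)
    invmx (first_fundamental_form G F t) a b *: cov_partial G F t a b).
Proof.
have sumE I (r : seq I) (f : I -> 'rV[R]_m) :
    normal_part G F t (\sum_(i <- r) f i) = \sum_(i <- r) normal_part G F t (f i).
  by apply: (big_morph _ (@normal_partD _ G F t) (@normal_part0 _ G F t)).
rewrite sumE; apply: eq_bigr => a _; rewrite sumE; apply: eq_bigr => b _.
by rewrite normal_partZ.
Qed.

(** [K + L + N = 0] stands for the Killing equation and [c] for the Christoffel term. *)
Lemma koszul_combination (K L N P Q c : R) : K + L + N = 0 ->
  c = 2^-1 * (P + K - Q) -> L + c = 2^-1 * (P - K - Q) - N.
Proof. by clear => KLN ->; have -> : L = - K - N; lra. Qed.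

(** The Killing equation trades the derivative of [X_b] along [X_a] for its derivative along [u].
    The first two remaining terms together are antisymmetric in [a] and [b]; the others, traced
    against the inverse Gram matrix, give minus half the trace of the derivative of the Gram matrix
    along [u]. *)
Lemma bil_cov_orbit (i : cidx M) (y u : 'rV[R]_m) (a b : 'I_n) : cimg i y ->
  bil (g i y) ('D_(X a i y) (field (basis_vec b) i) y +
    \row_c \sum_d \sum_e christoffel (g i) y c d e * X a i y 0 d * X b i y 0 e) u =
  2^-1 * (bil ('D_(X a i y) (g i) y) (X b i y) u
          - bil ('D_(X b i y) (g i) y) (X a i y) u
          - bil ('D_u (g i) y) (X a i y) (X b i y))
  - bil (g i y) (X a i y) ('D_u (field (basis_vec b) i) y).
Proof.
move=> iy; have dg := smooth_on_differentiable (smooth_riemannian g_riemannian i) iy.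
have entry v e f : 'D_v (fun z => g i z e f) y = ('D_v (g i) y) e f.
  by rewrite (derive_mx (diff_derivable dg)) mxE.
have Dg v : 'D_v (g i) y = \sum_d v 0 d *: 'D_(basis_vec d) (g i) y.
  exact: derive_basis.
have -> : \row_c \sum_d \sum_e christoffel (g i) y c d e * X a i y 0 d * X b i y 0 e
    = \row_c \sum_d \sum_e (2^-1 * \sum_f invmx (g i y) c f *
    ('D_(basis_vec d) (g i) y e f + 'D_(basis_vec e) (g i) y d f
     - 'D_(basis_vec f) (g i) y d e)) * X a i y 0 d * X b i y 0 e.
  apply/rowP => c; rewrite !mxE; apply: eq_bigr => d _; apply: eq_bigr => e _.
  congr (_ * _ * _); rewrite /christoffel; congr (_ * _); apply: eq_bigr => f _.
  by rewrite !entry.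
rewrite bilDl; apply: koszul_combination.
  exact: (killing act_smooth g_riemannian act_isometric).
exact: (bil_christoffel (riemannian_sym g_riemannian iy)
  (riemannian_unit g_riemannian iy) (Dg _) (Dg _) (Dg _)).
Qed.

Lemma mean_curvature_orbit (i : cidx M) p s0 :
  cdom i (act (torus_pi s0) p) ->
  gram act g i (orbit_in act i p s0) \in unitmx ->
  (forall u, 'D_u (fun y => \det (gram act g i y)) (orbit_in act i p s0) = 0) ->
  mean_curvature (g i) (orbit_in act i p) s0 = 0.
Proof.
move=> is0; set F := orbit_in act i p; set y := F s0 => Gu crit.
have iy : cimg i y by exact: cimg_cmap.
have nD : \forall s \near s0, cdom i (act (torus_pi s) p).
  by apply: open_nbhs_nbhs; split=> //; exact: open_orbit_in.
have partialE a s : cdom i (act (torus_pi s) p) -> partial F a s = X a i (F s).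
  exact: derive_orbit_in.
have FE : first_fundamental_form (g i) F s0 = gram act g i y.
  by apply/matrixP => a b; rewrite mxE gramE !partialE.
have covE a b : cov_partial (g i) F s0 a b = 'D_(X a i y) (field (basis_vec b) i) y +
    \row_c \sum_d \sum_e christoffel (g i) y c d e * X a i y 0 d * X b i y 0 e.
  rewrite /cov_partial (partialE a s0 is0) (partialE b s0 is0).
  apply: (congr1 (fun w => w + _)).
  have -> : 'D_(basis_vec a) (partial F b) s0 =
      'D_(basis_vec a) (field (basis_vec b) i \o F) s0.
    by apply: near_eq_derive; apply: filterS nD => s; exact: partialE.
  rewrite derive_chain.
  - by rewrite (derive_orbit_in act_smooth).
  - exact: (smooth_on_differentiable (smooth_orbit_in act_smooth i p)).
  - exact: (smooth_on_differentiable (smooth_field act_smooth _ i)).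
(* The trace [c] of the covariant derivatives vanishes even before projection. By positivity of the
   metric it suffices to pair [c] with itself, hence the derivatives along [c] below. *)
rewrite mean_curvatureE FE (_ : \sum_a _ = 0) ?normal_part0//.
apply: (riemannian_eq0 g_riemannian iy).
set c := \sum_a _.
rewrite {1}/c bil_suml.
pose E := \matrix_(a, b) bil ('D_c (g i) y) (X a i y) (X b i y).
pose L := \matrix_(a, b) bil (g i y) (X a i y) ('D_c (field (basis_vec b) i) y).
(* Jacobi's formula for the Gram determinant along [c]: its left side is 0 by [crit], and the
   determinant factor is nonzero. *)
have tr0 : \tr (invmx (gram act g i y) *m (E + L + L^T)) = 0.
  have hd := is_derive_det (is_derive_gram act_smooth g_riemannian c iy) Gu.
  have := @derive_val _ _ _ _ _ _ _ hd; rewrite crit => /esym/eqP.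
  rewrite mulf_eq0 => /orP[|/eqP <-].
    by move: Gu; rewrite unitmxE unitfE => /negP.
  apply: (congr1 (fun N => \tr (_ *m N))); apply/matrixP => a b; rewrite !mxE.
  have swap (r1 r2 r3 r4 : R) : r3 = r4 -> r1 + r2 + r3 = r1 + r4 + r2.
    by move=> ->; rewrite addrAC.
  by apply: swap; exact: (bilC _ _ (riemannian_sym g_riemannian iy)).
have ET : E^T = E.
  apply/matrixP => a b; rewrite !mxE; apply: bilC.
  rewrite (derive_mx (diff_derivable (smooth_on_differentiable
    (smooth_riemannian g_riemannian i) iy))).
  apply/matrixP => e f; rewrite !mxE; apply: near_eq_derive.
  apply: filterS (near_cimg iy) => z iz.
  by rewrite -[in RHS](riemannian_sym g_riemannian iz) mxE.
have ST : (invmx (gram act g i y))^T = invmx (gram act g i y).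
  by rewrite trmx_inv gram_sym.
rewrite -[RHS](trace_contraction
  (fun a b => bil ('D_(X a i y) (g i) y) (X b i y) c) ST ET tr0).
apply: eq_bigr => a _; rewrite bil_suml; apply: eq_bigr => b _.
rewrite bilZl; apply: (congr1 (fun x => _ * x)).
rewrite covE; apply: etrans (bil_cov_orbit _ _ _ iy) _.
by rewrite !mxE.
Qed.

End MeanCurvature.

(** * Critical orbits *)

Section RegularOrbits.
Context {R : realType} {n m : nat} {M : manifold R m}.
Variable act : torus R n -> M -> M.
Hypothesis act_smooth : smooth_action act.

Local Notation field := (fundamental_field act).
Local Notation actD := (actD act_smooth).

Lemma unit_cube_rep (s : 'rV[R]_n) : exists2 s', torus_pi s' = torus_pi s &
  forall k, s' 0 k \in `[0, 1].
Proof.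
pose z : 'rV[R]_n := \row_k (Num.floor (s 0 k))%:~R.
exists (s - z); last first.
  move=> k; rewrite !mxE in_itv/=.
  have /andP[f1 f2] := floor_itv (s 0 k).
  rewrite subr_ge0 f1/= lerBlDl ltW//.
  by move: f2; rewrite intrD.
rewrite torus_piD torus_piN (_ : torus_pi z = 0) ?oppr0 ?addr0//.
apply/eqP; rewrite torus_pi_eq0; apply/mxOverP => i k.
by rewrite mxE rpred_int.
Qed.

Section Orbit.
Variables (p : M) (r : R).
Hypothesis r0 : 0 < r.
Hypothesis discrete : forall e : 'rV[R]_n, `|e| < r -> act (torus_pi e) p = p -> e = 0.

Lemma act_sub_fix s t : act s p = act t p -> act (s - t) p = p.
Proof.
move=> st; rewrite addrC actD st -actD addNr.
by case: act_smooth.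
Qed.

(** If two stabilizing elements have representatives in the same cell, their difference is
    represented by a vector shorter than [r] and so vanishes; there are only finitely many cells. *)
Lemma discrete_regular : regular_orbit act p.
Proof.
pose N := Num.truncn r^-1.
have Nr : (N.+1%:R : R)^-1 < r by rewrite invf_plt ?posrE// truncnS_gt.
pose f (t : torus R n) := cell N (generic_quotient.repr t).
have piK (t : torus R n) : torus_pi (generic_quotient.repr t) = t.
  by rewrite /torus_pi reprK.
have finj : {in stabilizer act p &, injective f}.
  move=> s t /set_mem sp /set_mem tp /cell_close[z zZ zN].
  have piz : torus_pi z = 0 by apply/eqP; rewrite torus_pi_eq0.
  have := discrete (le_lt_trans zN Nr).
  rewrite !torus_piD !torus_piN !piK piz oppr0 addr0 => /(_ (act_sub_fix _)) /eqP.
  rewrite subr_eq0 => /(_ (etrans sp (esym tp)))/eqP st.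
  by apply/eqP; rewrite -subr_eq0 -(piK s) -(piK t) -torus_piN -torus_piD st piz.
by rewrite /regular_orbit -(eq_finite_set (inj_card_eq finj)).
Qed.

(** [V] is the saturation of [W] under the stabilizer. The orbit points outside the image of [W]
    form the image of the compact part of the unit cube outside [V], hence a closed set, and [Q] is
    its complement. *)
Lemma orbit_relatively_open (W : set 'rV[R]_n) : open W ->
  exists2 Q : set M, open Q & (fun s => act (torus_pi s) p) @` W = torus_orbit act p `&` Q.
Proof.
move=> oW; pose f (s : 'rV[R]_n) := act (torus_pi s) p.
have cf : continuous f by exact: continuous_act_orbit.
pose V := [set s | exists2 w, W w & f s = f w].
have oV : open V.
  rewrite openE => s [w Ww sw]; rewrite /interior /=.
  (* Translation by [s - w], which stabilizes [p], brings the points near [s] back into [W]. *)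
  have : \forall s' \near s, W (s' - (s - w)).
    have c : {for s, continuous (fun s' : 'rV[R]_n => s' - (s - w))}.
      exact: differentiable_continuous.
    have Ws : nbhs (s - (s - w)) W.
      by rewrite opprB addrC subrK; exact: open_nbhs_nbhs.
    exact: (c W Ws).
  apply: filterS => s' Ws'; exists (s' - (s - w)) => //.
  rewrite /f torus_piD actD; congr act; apply: esym.
  by rewrite torus_piN; apply: act_fixN => //; rewrite torus_piD torus_piN; exact: act_sub_fix.
pose cube := [set s : 'rV[R]_n | forall k, `[0, 1]%classic (s ord0 k)].
have cK : compact (cube `&` ~` V).
  apply: compact_closedI; last exact: open_closedC.
  by apply: (@rV_compact R n (fun=> `[0, 1]%classic)) => _; exact: segment_compact.
exists (~` (f @` (cube `&` ~` V))).
  apply: closed_openC; apply: compact_closed; first exact: man_hausdorff.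
  by apply: continuous_compact => //; exact: continuous_subspaceT.
apply/seteqP; split=> q.
  move=> [w Ww <-]; split; first by exists (torus_pi w).
  by move=> [s [_ nV] sw]; apply: nV; exists w.
move=> [[t _ <-]]; have [s <-] := torus_pi_surj t => nK.
have [s' s's cs] := unit_cube_rep s.
have [w Ww fw] : V s'.
  apply: contrapT => nV; apply: nK; exists s'; last by rewrite /f s's.
  by split=> // k; exact: cs.
by exists w => //; rewrite -/(f w) -fw /f s's.
Qed.

(** Two points of a ball of radius [r / 2] differ by less than [r], so [discrete] makes the orbit
    map injective there. *)
Lemma orbit_parametrization s0 :
  (forall s (i : cidx M), cdom i (act (torus_pi s) p) ->
    forall u, field u i (orbit_in act i p s) = 0 -> u = 0) ->
  local_parametrization (torus_orbit act p) (ball s0 (r / 2))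
    (fun s => act (torus_pi s) p).
Proof.
move=> imm; split.
- exact: ball_open.
- split=> [s _|i]; first exact: continuous_act_orbit.
  apply: (smooth_on_affine (A := id) (B := id) _ _ _ (smooth_orbit_in act_smooth i p)) => //.
- move=> t u i _ it; rewrite (derive_orbit_in act_smooth u it).
  exact: imm.
- move=> s t /set_mem sB /set_mem tB st; apply/eqP; rewrite -subr_eq0; apply/eqP.
  apply: discrete; last by rewrite torus_piD torus_piN; exact: act_sub_fix.
  move: sB tB; rewrite -ball_normE/= => sB tB.
  rewrite -(subrKA s0) (le_lt_trans (ler_normD _ _))// [r]splitr ltrD//.
  by rewrite distrC.
- by move=> W oW _; exact: orbit_relatively_open.
Qed.

End Orbit.
End RegularOrbits.

(** * The orbit volume as a function on the manifold, and its maximum *)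

Section Volume.
Context {R : realType} {n m : nat} {M : manifold R m}.
Variables (act : torus R n -> M -> M) (g : components M).
Hypothesis act_smooth : smooth_action act.
Hypothesis g_riemannian : riemannian_metric g.
Hypothesis act_isometric : forall t : torus R n, preserves (act t) g.

Local Notation field := (fundamental_field act).

(** The squared volume of the parallelepiped spanned by the fundamental fields at [x], in a chart
    picked by choice; [gram_detE] shows that the chart does not matter. *)
Definition gram_det (x : M) : R :=
  let i := sval (cid (cdom_cover x)) in \det (gram act g i (cmap i x)).

(** One statement covers invariance under the action and, for [t = 0], independence of the chart. *)
Lemma gram_detE t j x : cdom j (act t x) ->
  gram_det x = \det (gram act g j (cmap j (act t x))).
Proof.
rewrite /gram_det; case: cid => i /= ix jx.
have iy := cimg_cmap ix.
have := gram_act act_smooth act_isometric (t := t) (j := j) iy.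
rewrite (cdomK ix) => /(_ jx) E.
exact: (congr1 determinant (esym E)).
Qed.

Lemma gram_det_chart j x : cdom j x -> gram_det x = \det (gram act g j (cmap j x)).
Proof. by move=> jx; rewrite (gram_detE (t := 0) (j := j)) act0. Qed.

Lemma continuous_gram_det : continuous gram_det.
Proof.
move=> x; have [i ix] := cdom_cover x; have iy := cimg_cmap ix.
have cD : {for cmap i x, continuous (fun y => \det (gram act g i y))}.
  apply: continuous_det => a b.
  rewrite (_ : (fun t => _) = fun y => bil (g i y) (field (basis_vec a) i y)
    (field (basis_vec b) i y)); last by apply/funext => z; rewrite gramE.
  apply: continuous_bil.
  - exact: (smooth_on_continuous (smooth_riemannian g_riemannian i) iy).
  - exact: (smooth_on_continuous (smooth_field act_smooth _ i) iy).
  - exact: (smooth_on_continuous (smooth_field act_smooth _ i) iy).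
have : {for x, continuous (fun x => \det (gram act g i (cmap i x)))}.
  by apply: (@continuous_comp _ _ _ (cmap i) (fun y => \det (gram act g i y))) => //;
    exact: continuous_cmap.
move=> c; rewrite /continuous_at [X in _ --> X](gram_det_chart ix).
apply: cvg_trans c; apply: near_eq_cvg; apply: filterS (near_cdom ix) => z iz.
exact: esym (gram_det_chart iz).
Qed.

(** By invariance the square is also maximal at [act t p], and near that point the chart determinant
    computes [gram_det]. *)
Lemma gram_det_critical (p : M) : (forall x, gram_det x ^+ 2 <= gram_det p ^+ 2) ->
  gram_det p != 0 -> forall t (i : cidx M) u, cdom i (act t p) ->
  'D_u (fun y => \det (gram act g i y)) (cmap i (act t p)) = 0.
Proof.
move=> pmax p0 t i u ip; have iy := cimg_cmap ip.
apply: derive_sqr_at_max.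
- apply: filterS (near_cimg iy) => z iz v; apply: derivable_det.
  by have [] := is_derive_gram act_smooth g_riemannian v iz.
- apply: filterS (near_cimg iy) => z iz.
  have := pmax (cinv i z).
  by rewrite (gram_detE ip) (gram_det_chart (cdom_cinv iz)) (cimgK iz).
- by rewrite -(gram_detE ip).
Qed.

Lemma minimal_regular_orbit : compact [set: M] -> connected [set: M] ->
  [set: M] !=set0 -> effective act ->
  exists p : M, regular_orbit act p /\ minimal_submanifold g n (torus_orbit act p).
Proof.
move=> Mc Mconn M0 eff.
(* The square spares us the sign of the Gram determinant. *)
have [p _ pmax] : exists2 p, p \in [set: M] & forall x, x \in [set: M] ->
    gram_det x ^+ 2 <= gram_det p ^+ 2.
  apply: compact_EVT_max => //; apply: continuous_subspaceT => x.
  apply: (@continuous_comp _ _ _ gram_det (fun a => a ^+ 2)).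
    exact: continuous_gram_det.
  exact: exprn_continuous.
have {}pmax x : gram_det x ^+ 2 <= gram_det p ^+ 2 by apply: pmax; rewrite in_setT.
(* Where the fundamental fields are independent the determinant is nonzero, so the maximum of the
   square is positive. *)
have p0 : gram_det p != 0.
  have [i [y [iy free]]] := exists_free act_smooth Mconn M0 eff.
  have := pmax (cinv i y).
  rewrite (gram_det_chart (cdom_cinv iy)) (cimgK iy); apply: contraTneq => ->.
  rewrite expr0n/= -ltNge lt_neqAle sqr_ge0 andbT eq_sym expf_neq0//.
  by rewrite -unitfE -unitmxE; exact/gram_unit.
have unit_orbit t i : cdom i (act t p) -> gram act g i (cmap i (act t p)) \in unitmx.
  by move=> it; rewrite unitmxE unitfE -(gram_detE it).
have free_orbit t i : cdom i (act t p) -> forall v, field v i (cmap i (act t p)) = 0 -> v = 0.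
  by move=> it; apply/(gram_unit act_smooth g_riemannian (cimg_cmap it)); exact: unit_orbit.
have [i ip] := cdom_cover p.
have ip' : cdom i (act 0 p) by rewrite act0.
have [r r0 rker] := near_fixed_ker act_smooth (cimg_cmap ip).
(* The fields are independent at [p], so [near_fixed_ker] leaves 0 as the only small stabilizing
   vector. *)
have discrete e : `|e| < r -> act (torus_pi e) p = p -> e = 0.
  move=> er ep; apply: (free_orbit _ _ ip'); rewrite act0//.
  by apply: rker => //; rewrite cdomK.
exists p; split; first exact: discrete_regular discrete.
move=> q [t _ tq]; have [s st] := torus_pi_surj t.
exists (ball s (r / 2)), (fun s => act (torus_pi s) p); split.
- by apply: orbit_parametrization => // s' j js'; exact: free_orbit.
- by exists s; [apply: ballxx; rewrite divr_gt0|rewrite st].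
- move=> s' j _ js'; apply: mean_curvature_orbit => //; first exact: unit_orbit.
  by move=> u; exact: gram_det_critical.
Qed.

End Volume.

Theorem lemma2 (R : realType) (n : nat) (M : manifold R (2 * n))
    (omega g : components M) (act : torus R n -> M -> M)
    (M_nonempty : [set: M] !=set0)
    (M_compact : compact [set: M])
    (M_connected : connected [set: M])
    (omega_symplectic : symplectic_form omega)
    (g_riemannian : riemannian_metric g)
    (act_smooth : smooth_action act)
    (act_effective : effective act)
    (act_hamiltonian : hamiltonian act omega)
    (act_isometric : forall t : torus R n, preserves (act t) g) :
  exists p : M, regular_orbit act p /\ minimal_submanifold g n (torus_orbit act p).
Proof. exact: minimal_regular_orbit. Qed.
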